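(* Let $\Omega\subset\mathbb{S}^2$ be a simply connected domain whose boundary has more than two points, let $\alpha<0$, and let $\Sigma=\Sigma(\rho_\Omega+t)$, $t=-\tfrac12\log(-\alpha)$, be the $\alpha$-Weingarten surface over $\Omega$. Then (at the non-umbilic points where the surface is smooth) the lines of curvature of $\Sigma$ project under the Gauss map of $\Sigma$ to the positive and negative trajectories of the holomorphic quadratic differential $q_\Omega=\mathcal{S}_\Omega(z)\,dz^2$ on $\Omega$.
   Context: Hyperbolic 3-space $\mathbb{H}^3$ is the open unit ball in $\mathbb{R}^3$ with metric $4|dx|^2/(1-|x|^2)^2$; its ideal boundary is the unit sphere $\mathbb{S}^2$, with round metric $d\sigma^2$. For a function $\rho$ on a domain $\Omega\subset\mathbb{S}^2$, define $R_\rho:\Omega\to\mathbb{H}^3$ by $$R_\rho(\theta)=\frac{|D\rho|^2+(e^{2\rho}-1)}{|D\rho|^2+(e^{\rho}+1)^2}\,\theta+\frac{2D\rho}{|D\rho|^2+(e^\rho+1)^2},$$ where $D\rho$ is the gradient of $\rho$ with respect to $d\sigma^2$, regarded as a vector in $\mathbb{R}^3$ tangent to $\mathbb{S}^2$ at $\theta$. $\Sigma(\rho)$ is the surface parametrized by $R_\rho$ (the outer envelope of the horospheres $H(\theta,\rho(\theta))$ based at $\theta$ with signed distance $\rho(\theta)$ from the origin), with unit normal $N$ at $R_\rho(\theta)$ pointing into the horoball bounded by $H(\theta,\rho(\theta))$. The Gauss map sends a point $p$ of the surface to the endpoint in $\mathbb{S}^2$ of the geodesic ray from $p$ with initial velocity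 $N$; thus it sends $R_\rho(\theta)$ to $\theta$. Lines of curvature are the integral curves of the principal directions (eigendirections of the second fundamental form). Let $f_\Omega:\Omega\to D_1$ be a conformal bijection onto the unit disk of $\mathbb{C}$. In a local conformal parameter $z$ with $d\sigma^2=\gamma^2|dz|^2$, put $\rho_\Omega=\log\big(2|f_\Omega'|\gamma^{-1}(1-|f_\Omega|^2)^{-1}\big)$ and $\mathcal{S}_\Omega=\big(\tfrac{f_\Omega''}{f_\Omega'}\big)'-\tfrac12\big(\tfrac{f_\Omega''}{f_\Omega'}\big)^2$. The quadratic differential $q_\Omega$ is well defined on $\Omega$ (using stereographic parameters $z$). Its positive (resp. negative) trajectories are the integral curves, away from the zeros of $q_\Omega$, of the line fields along which $q_\Omega>0$ (resp. $q_\Omega<0$), i.e. the two line fields defined by $\operatorname{Im}q_\Omega=0$. An $\alpha$-Weingarten surface satisfies $k_1k_2-1=\alpha(1-k_1)(1-k_2)$ at its smooth points, where $k_1,k_2$ are the principal curvatures. *)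

(* Defs.v *)
From HB Require Import structures.
From mathcomp Require Import all_boot all_order all_algebra.
From mathcomp Require Import complex.
From mathcomp Require Import all_classical all_reals all_analysis.
Import Order.TTheory GRing.Theory Num.Theory.
Import numFieldNormedType.Exports.

Set Implicit Arguments.
Unset Strict Implicit.
Unset Printing Implicit Defensive.

Local Open Scope classical_set_scope.
Local Open Scope ring_scope.

(* ['rV[R]_3] is R^3; its library norm is the sup norm (same topology), so the
   Euclidean structure is introduced through [dot]. *)
Section Euclidean.
Context {R : realType}.
Local Notation E := 'rV[R]_3.

Definition dot (u v : E) : R := \sum_(i < 3) u ord0 i * v ord0 i.

Definition vec3 (a b c : R) : E :=
  \row_(i < 3) (if val i == 0%N then a else if val i == 1%N then b else c).

Definition sphere : set E := [set x | dot x x = 1].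

Definition unit_ball : set E := [set x | dot x x < 1].

Definition tangent (theta v : E) : Prop := dot theta v = 0.

(* Maps on (subsets of) the sphere are differentiated through their extension
   that is homogeneous of degree 0; for v tangent at theta this is the
   derivative along the curve s |-> (theta + s v) / |theta + s v|. *)
Definition radial (x : E) : E := (Num.sqrt (dot x x))^-1 *: x.

Definition sdiff {W : normedModType R} (F : E -> W) (theta v : E) : W :=
  'D_v (F \o radial) theta.

(* The Euclidean gradient of the degree 0 extension is automatically tangent
   to the sphere, hence equal to the gradient for the round metric. *)
Definition sgrad (rho : E -> R) (theta : E) : E :=
  \row_(i < 3) sdiff rho theta (delta_mx ord0 i).

End Euclidean.

Section Domains.
Context {R : realType}.
Local Notation E := 'rV[R]_3.

Definition sphere_domain (Omega : set E) : Prop :=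
  [/\ Omega !=set0,
      exists2 U : set E, open U & Omega = U `&` sphere
    & connected Omega].

(* [g] is a loop in Omega; [H] contracts it to its base point. *)
Definition simply_connected (Omega : set E) : Prop :=
  forall g : R -> E,
    {within `[0, 1]%classic, continuous g} ->
    (forall s, s \in `[0, 1] -> Omega (g s)) ->
    g 0 = g 1 ->
    exists H : R * R -> E,
      [/\ {within `[0, 1]%classic `*` `[0, 1]%classic, continuous H},
          forall s u, s \in `[0, 1] -> u \in `[0, 1] -> Omega (H (s, u)),
          forall s, s \in `[0, 1] -> H (s, 0) = g s,
          forall s, s \in `[0, 1] -> H (s, 1) = g 0
        & forall u, u \in `[0, 1] -> H (0, u) = g 0 /\ H (1, u) = g 0].

(* Boundary relative to the sphere. *)
Definition sphere_boundary (Omega : set E) : set E :=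
  closure Omega `&` closure (sphere `\` Omega).

Definition more_than_two_points (B : set E) : Prop :=
  exists a b c, [/\ B a, B b & B c] /\ [/\ a <> b, b <> c & a <> c].

End Domains.

Section StereographicParameters.
Context {R : realType}.
Local Notation E := 'rV[R]_3.
Local Notation C := (R[i])^o.

Definition rotation (A : 'M[R]_3) : Prop := A *m A^T = 1%:M /\ \det A = 1.

(* Inverse stereographic projection from (0,0,1), followed by a rotation.
   These parametrizations form a holomorphic atlas of the Riemann sphere. *)
Definition stereo (A : 'M[R]_3) (z : C) : E :=
  let r2 := (complex.Re z) ^+ 2 + (complex.Im z) ^+ 2 in
  ((1 + r2)^-1 *: vec3 (2 * complex.Re z) (2 * complex.Im z) (r2 - 1)) *m A.

(* In each of these parameters the round metric is (stereo_factor z)^2 |dz|^2. *)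
Definition stereo_factor (z : C) : R :=
  2 / (1 + (complex.Re z) ^+ 2 + (complex.Im z) ^+ 2).

(* Tangent vector at [stereo A z] with dz-coordinate [zeta]; the parameter s
   is real. *)
Definition stereo_diff (A : 'M[R]_3) (z zeta : C) : E :=
  derive1 (fun s : R => stereo A (z + s%:C%C * zeta)) 0.

Definition unit_disk : set C := [set w | ComplexField.Normc.normc w < 1].

(* A conformal diffeomorphism: bijective and, in every stereographic
   parameter, of class C^infinity in the complex sense with nonvanishing
   complex derivative. *)
Definition conformal_bijection (Omega : set E) (f : E -> C) : Prop :=
  set_bij Omega unit_disk f /\
  forall (A : 'M[R]_3) (z : C), rotation A -> Omega (stereo A z) ->
    (forall n, derivable (derive1n n (f \o stereo A)) z 1) /\
    derive1 (f \o stereo A) z != 0.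

(* [rhoO] is the function rho_Omega determined by [f]: the formula is imposed
   in every stereographic parameter, its value not depending on the choice. *)
Definition is_rho_Omega (Omega : set E) (f : E -> C) (rhoO : E -> R) : Prop :=
  forall (A : 'M[R]_3) (z : C), rotation A -> Omega (stereo A z) ->
    rhoO (stereo A z) =
      ln (2 * ComplexField.Normc.normc (derive1 (f \o stereo A) z)
            * (stereo_factor z)^-1
            * (1 - ComplexField.Normc.normc (f (stereo A z)) ^+ 2)^-1).

Definition schwarzian (h : C -> C) : C -> C :=
  let P : C -> C := fun z => derive1n 2 h z / derive1 h z in
  fun z => derive1 P z - 2^-1 * P z ^+ 2.

(* Value of the quadratic differential q_Omega, read in the parameter
   [stereo A], on the tangent vector with dz-coordinate [zeta] at [z]. *)
Definition q_Omega (f : E -> C) (A : 'M[R]_3) (z zeta : C) : C :=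
  schwarzian (f \o stereo A) z * zeta ^+ 2.

(* The order on R[i] is the partial one: 0 < w means that w is real and
   positive. *)
Definition q_positive (f : E -> C) (theta v : E) : Prop :=
  forall (A : 'M[R]_3) (z zeta : C), rotation A ->
    stereo A z = theta -> stereo_diff A z zeta = v ->
    (0 : R[i]) < q_Omega f A z zeta.

Definition q_negative (f : E -> C) (theta v : E) : Prop :=
  forall (A : 'M[R]_3) (z zeta : C), rotation A ->
    stereo A z = theta -> stereo_diff A z zeta = v ->
    q_Omega f A z zeta < (0 : R[i]).

End StereographicParameters.

Section HyperbolicSpace.
Context {R : realType}.
Local Notation E := 'rV[R]_3.

(* The hyperbolic metric on the ball is (hyp_factor p)^2 |dx|^2. *)
Definition hyp_factor (p : E) : R := 2 / (1 - dot p p).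

Definition hyp_dot (p u v : E) : R := hyp_factor p ^+ 2 * dot u v.

(* Levi-Civita covariant derivative, in direction [X] at [p], of a field with
   value [Y] and Euclidean derivative [dY]:
     dY + X(log l) Y + Y(log l) X - <X, Y> grad (log l),  l = hyp_factor,
   where grad (log l) = l p. *)
Definition hyp_nabla (p X Y dY : E) : E :=
  dY + hyp_factor p *: (dot p X *: Y + dot p Y *: X - dot X Y *: p).

Definition hyp_geodesic (g : R -> E) : Prop :=
  forall s : R, [/\ unit_ball (g s), derivable g s 1, derivable (derive1 g) s 1
    & hyp_nabla (g s) (derive1 g s) (derive1 g s) (derive1n 2 g s) = 0].

(* [xi] is the ideal endpoint of the geodesic ray from [p] with initial
   velocity [v]. *)
Definition ideal_endpoint (p v xi : E) : Prop :=
  exists g : R -> E, [/\ hyp_geodesic g, g 0 = p, derive1 g 0 = v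
    & g s @[s --> +oo] --> xi].

(* Open horoball bounded by the horosphere H(theta, r): the Busemann function
   at theta vanishing at the origin is ln (|x - theta|^2 / (1 - |x|^2)), and
   H(theta, r) is its level set at height -r. *)
Definition horoball (theta : E) (r : R) : set E :=
  [set x | unit_ball x /\
           dot (x - theta) (x - theta) < expR (- r) * (1 - dot x x)].

End HyperbolicSpace.

Section Surface.
Context {R : realType}.
Local Notation E := 'rV[R]_3.
Variables (Omega : set E) (rho : E -> R).

Definition R_map (theta : E) : E :=
  let D := sgrad rho theta in
  let e := expR (rho theta) in
  let d := dot D D + (e + 1) ^+ 2 in
  ((dot D D + (expR (2 * rho theta) - 1)) / d) *: theta + (2 / d) *: D.

Definition immersed_at (theta : E) : Prop :=
  forall v, tangent theta v -> sdiff R_map theta v = 0 -> v = 0.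

Definition outer_unit_normal (N : E -> E) : Prop :=
  forall theta, Omega theta -> immersed_at theta ->
    [/\ hyp_dot (R_map theta) (N theta) (N theta) = 1,
        forall v, tangent theta v ->
          hyp_dot (R_map theta) (N theta) (sdiff R_map theta v) = 0
      & \forall s \near 0^'+,
          horoball theta (rho theta) (R_map theta + s *: N theta)].

Variable N : E -> E.

Definition first_form (theta v w : E) : R :=
  hyp_dot (R_map theta) (sdiff R_map theta v) (sdiff R_map theta w).

Definition second_form (theta v w : E) : R :=
  - hyp_dot (R_map theta)
      (hyp_nabla (R_map theta) (sdiff R_map theta v) (N theta)
                 (sdiff N theta v))
      (sdiff R_map theta w).

(* Directions on the surface are represented by their preimages under the
   differential of [R_map]. *)
Definition principal_direction (theta v : E) : Prop :=
  [/\ tangent theta v, v <> 0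
    & exists k : R, forall w, tangent theta w ->
        second_form theta v w = k * first_form theta v w].

Definition umbilic (theta : E) : Prop :=
  exists k : R, forall v w, tangent theta v -> tangent theta w ->
    second_form theta v w = k * first_form theta v w.

Definition smooth_nonumbilic (theta : E) : Prop :=
  [/\ Omega theta, immersed_at theta & ~ umbilic theta].

Definition gauss_map (theta xi : E) : Prop :=
  ideal_endpoint (R_map theta) (N theta) xi.

End Surface.

Section Curves.
Context {R : realType}.
Local Notation E := 'rV[R]_3.
Local Notation C := (R[i])^o.

Definition open_interval (J : set R) : Prop :=
  [/\ J !=set0, open J & is_interval J].

Definition regular_curve (J : set R) (c : R -> E) : Prop :=
  forall s, J s ->
    [/\ derivable c s 1, {for s, continuous (derive1 c)} & derive1 c s <> 0].

(* The curve [R_map rho \o c] on the surface, given through its lift [c] to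
   the parameter domain. *)
Definition line_of_curvature (Omega : set E) (rho : E -> R) (N : E -> E)
    (J : set R) (c : R -> E) : Prop :=
  regular_curve J c /\
  forall s, J s -> smooth_nonumbilic Omega rho N (c s) /\
                   principal_direction rho N (c s) (derive1 c s).

Definition positive_trajectory (Omega : set E) (f : E -> C)
    (J : set R) (c : R -> E) : Prop :=
  regular_curve J c /\
  forall s, J s -> Omega (c s) /\ q_positive f (c s) (derive1 c s).

Definition negative_trajectory (Omega : set E) (f : E -> C)
    (J : set R) (c : R -> E) : Prop :=
  regular_curve J c /\
  forall s, J s -> Omega (c s) /\ q_negative f (c s) (derive1 c s).

End Curves.

(* Main.v *)
Require Import Defs.
From HB Require Import structures.
From mathcomp Require Import all_boot all_order all_algebra.
From mathcomp Require Import complex ring lra.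
From mathcomp Require Import all_classical all_reals all_analysis.
Import Order.TTheory GRing.Theory Num.Theory.
Import numFieldNormedType.Exports.

Set Implicit Arguments.
Unset Strict Implicit.
Unset Printing Implicit Defensive.

Local Open Scope classical_set_scope.
Local Open Scope ring_scope.

(** Write [e = exp rho], [D] for the gradient of rho and
    [P = D - (e + 1) theta]. Then [R_map rho theta = theta + 2 P / |P|^2], and
    the differential of this map at [theta] is
    [v |-> (2 / |P|^2) Refl_P (M v)], where [Refl_P] is the reflection in the
    plane orthogonal to [P] and [M] is the self-adjoint operator
    [Hess rho - D (x) D + c Id] of the tangent plane of the sphere (lemma
    [sdiff_R_map]). The same reflection carries [theta] to a multiple of the
    outer normal ([horo_normalE], [normal_chart]). Hence
    [I (v, w) = M v . M w / e^2] and [II (v, w) = I (v, w) - v . M w]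
    ([first_form_tang], [second_form_tang]), and at an immersed point, where [M]
    is invertible, the principal directions are the eigendirections of [M]:
    those of the trace-free part of [Hess rho - D (x) D]. Adding a constant to
    rho changes only [c], which is why the directions do not depend on [t].

    In a stereographic parameter [z], with [h] the conformal map read in that
    parameter, [2 d_z rho] is
    [h''/h' + 2 h' conj h / (1 - |h|^2) + 2 conj z / (1 + |z|^2)], and its
    derivative in [z], minus half its square and corrected by the Christoffel
    symbols, is the Schwarzian [S] of [h] ([der_rho_x], [der_rho_y],
    [shape_chart_identity]). So [M] acts on a vector with component [zeta] as
    [zeta |-> m zeta + conj (S zeta) / gamma^2] with [m] real, and [zeta] is an
    eigendirection exactly when [S zeta^2] is real ([principal_chart]). The
    Schwarzian does not vanish at a nonumbilic point, so there [S zeta^2] is a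
    nonzero real number. Its value is read off from the trace-free part of [M],
    which is defined without charts ([tracefree]); it is therefore independent
    of the parameter and continuous along a regular curve, and has a constant
    sign on an interval.

    It remains to see that the Gauss map sends [R_map rho theta] to [theta] and
    to nothing else ([ideal_endpoint_horosphere]). In the hyperboloid model the
    geodesic equation becomes the linear equation [Y'' = Y], which gives both
    the geodesic that joins the point to [theta] and the uniqueness of the
    endpoint.

    All derivatives on the sphere are computed along curves lifted to a chart,
    so that on the real side only functions of one variable are differentiated. *)

(** * One-variable differentiation *)

Section Calculus.
Context {R : realType}.
Implicit Types (f g : R -> R) (s : R).

(** An alias of [is_derive] that is not a class: instance search would choose
    the form in which a derivative is expressed. *)
Definition has_der {V : normedModType R} (f : R -> V) s (df : V) : Prop :=
  is_derive s 1 f df.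

Lemma derEq {V : normedModType R} (f : R -> V) s df dg :
  has_der f s df -> df = dg -> has_der f s dg.
Proof. by rewrite /has_der; move=> ? <-. Qed.

Lemma derD f g s df dg : has_der f s df -> has_der g s dg ->
  has_der (fun u => f u + g u) s (df + dg).
Proof. by rewrite /has_der; move=> ? ?; exact: is_deriveD. Qed.

Lemma derB f g s df dg : has_der f s df -> has_der g s dg ->
  has_der (fun u => f u - g u) s (df - dg).
Proof. by rewrite /has_der; move=> ? ?; exact: is_deriveB. Qed.

Lemma derN f s df : has_der f s df -> has_der (fun u => - f u) s (- df).
Proof. by rewrite /has_der; move=> ?; exact: is_deriveN. Qed.

Lemma derM f g s df dg : has_der f s df -> has_der g s dg ->
  has_der (fun u => f u * g u) s (df * g s + f s * dg).
Proof.
rewrite /has_der.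
move=> Hf Hg; have H := is_deriveM Hf Hg.
by refine (derEq H _); rewrite addrC; congr (_ + _); exact: mulrC.
Qed.

Lemma derX f s df n : has_der f s df ->
  has_der (fun u => f u ^+ n) s (n%:R * f s ^+ n.-1 * df).
Proof.
rewrite /has_der.
by move=> Hf; have := is_deriveX n Hf; rewrite exprfctE.
Qed.

Lemma derV f s df : f s != 0 -> has_der f s df ->
  has_der (fun u => (f u)^-1) s (- df / f s ^+ 2).
Proof.
rewrite /has_der.
move=> f0 Hf; have H := is_deriveV f0 Hf.
by refine (derEq H _); rewrite [LHS]mulNr mulNr mulrC.
Qed.

Lemma derC (c : R) s : has_der (fun _ : R => c) s 0.
Proof. rewrite /has_der; exact: is_derive_cst. Qed.

Lemma derI s : has_der (fun u : R => u) s 1.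
Proof. rewrite /has_der; exact: is_derive_id. Qed.

Lemma der_ln f s df : 0 < f s -> has_der f s df ->
  has_der (fun u => ln (f u)) s (df / f s).
Proof.
rewrite /has_der.
move=> f0 Hf; have H := is_derive1_comp (is_derive1_ln f0) Hf.
by refine (derEq H _); rewrite mulrC.
Qed.

Lemma der_exp f s df : has_der f s df ->
  has_der (fun u => expR (f u)) s (df * expR (f s)).
Proof.
rewrite /has_der.
move=> Hf; have H := is_derive1_comp (is_derive_expR (f s)) Hf.
by refine (derEq H _); rewrite mulrC.
Qed.

Lemma der_sqrt f s df : 0 < f s -> has_der f s df ->
  has_der (fun u => Num.sqrt (f u)) s (df / (2 * Num.sqrt (f s))).
Proof.
rewrite /has_der.
move=> f0 Hf; have H := is_derive1_comp (is_derive1_sqrt f0) Hf.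
by refine (derEq H _); rewrite mulrC.
Qed.

Lemma der_cont {V : normedModType R} (f : R -> V) s df :
  has_der f s df -> {for s, continuous f}.
Proof.
rewrite /has_der.
by case=> /derivable1_diffP /differentiable_continuous.
Qed.

Lemma der_near_neq0 f s df : has_der f s df -> f s != 0 ->
  \forall u \near s, f u != 0.
Proof.
move=> /der_cont cf f0; apply: (cf [set t | t != 0]).
by apply: open_nbhs_nbhs; split=> //; exact: open_neq.
Qed.

Lemma der_near {V : normedModType R} (f g : R -> V) s df :
  (\forall u \near s, f u = g u) -> has_der f s df -> has_der g s df.
Proof. rewrite /has_der; exact: near_eq_is_derive. Qed.

Lemma derP {V : normedModType R} (f : R -> V) s :
  derivable f s 1 -> has_der f s (derive1 f s).
Proof. by rewrite /has_der; move=> H; rewrite derive1E; exact: derivableP. Qed.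

Lemma der_val {V : normedModType R} (f : R -> V) s df :
  has_der f s df -> derive1 f s = df.
Proof. by rewrite /has_der; move=> H; rewrite derive1E derive_val. Qed.

Lemma der_uniq {V : normedModType R} (f : R -> V) s df dg :
  has_der f s df -> has_der f s dg -> df = dg.
Proof. by rewrite /has_der; move=> /der_val <- /der_val. Qed.

Lemma der_row n (F : R -> 'rV[R]_n) s F' :
  has_der F s F' <->
  forall i, has_der (fun u => F u ord0 i) s (F' ord0 i).
Proof.
rewrite /has_der.
split=> [[dF <-] i|H].
  have dFi : derivable (fun u => F u ord0 i) s 1.
    by apply: (derivable_mxP F s 1).1.
  by rewrite derive_mx // mxE; exact: derivableP.
have dF : derivable F s 1.
  by apply/derivable_mxP => i j; rewrite (ord1 i); case: (H j).
apply: DeriveDef => //; rewrite derive_mx //; apply/rowP => j; rewrite mxE.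
by case: (H j).
Qed.

End Calculus.

Ltac der_step :=
  first [ eassumption | apply: derI | apply: derC | apply: derD | apply: derB
        | apply: derN | apply: derM | apply: derX | apply: derV | apply: der_ln
        | apply: der_exp | apply: der_sqrt ].
Ltac der := eapply derEq; [ solve [repeat der_step] | cbv beta ].

(** * Euclidean 3-space *)

Section EuclideanAlgebra.
Context {R : realType}.
Local Notation E := 'rV[R]_3.
Implicit Types (u v w x y : E) (k : R).

Lemma dotC u v : dot u v = dot v u.
Proof. by apply: eq_bigr => i _; rewrite mulrC. Qed.

Lemma dotDl u v w : dot (u + v) w = dot u w + dot v w.
Proof. by rewrite -big_split; apply: eq_bigr => i _; rewrite mxE mulrDl. Qed.

Lemma dotZl k u w : dot (k *: u) w = k * dot u w.
Proof. by rewrite /dot mulr_sumr; apply: eq_bigr => i _; rewrite mxE mulrA. Qed.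

Lemma dotDr u v w : dot w (u + v) = dot w u + dot w v.
Proof. by rewrite dotC dotDl !(dotC w). Qed.

Lemma dotZr k u w : dot w (k *: u) = k * dot w u.
Proof. by rewrite dotC dotZl dotC. Qed.

Lemma dotNl u w : dot (- u) w = - dot u w.
Proof. by rewrite -scaleN1r dotZl mulN1r. Qed.

Lemma dotNr u w : dot w (- u) = - dot w u.
Proof. by rewrite dotC dotNl dotC. Qed.

Definition dotE := (dotDl, dotDr, dotNl, dotNr, dotZl, dotZr).

Lemma dot0l u : dot 0 u = 0.
Proof. by rewrite -(scale0r 0) dotZl mul0r. Qed.

Lemma dot_ge0 u : 0 <= dot u u.
Proof. by apply: sumr_ge0 => i _; rewrite -expr2 sqr_ge0. Qed.

Lemma dot_eq0 u : dot u u = 0 -> u = 0.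
Proof.
move/eqP; rewrite psumr_eq0 => [/allP H|i _]; last by rewrite -expr2 sqr_ge0.
apply/rowP => i; rewrite mxE; apply/eqP.
by have := H i (mem_index_enum _); rewrite mulf_eq0 orbb.
Qed.

Lemma dot_delta u i : dot u (delta_mx ord0 i) = u ord0 i.
Proof.
rewrite /dot (bigD1 i) //= big1 ?addr0 ?mxE ?eqxx ?mulr1 // => j ji.
by rewrite mxE (negbTE ji) andbF mulr0.
Qed.

End EuclideanAlgebra.

Section VectorCalculus.
Context {R : realType}.
Local Notation E := 'rV[R]_3.
Implicit Types (F G : R -> E) (k : R -> R) (s : R).

Lemma derDv F G s dF dG : has_der F s dF -> has_der G s dG ->
  has_der (fun u => F u + G u) s (dF + dG).
Proof. by rewrite /has_der; move=> ? ?; exact: is_deriveD. Qed.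

Lemma derNv F s dF : has_der F s dF -> has_der (fun u => - F u) s (- dF).
Proof. by rewrite /has_der; move=> ?; exact: is_deriveN. Qed.

Lemma derCv (c : E) s : has_der (fun _ : R => c) s 0.
Proof. exact: is_derive_cst. Qed.

Lemma derZv k F s dk dF : has_der k s dk -> has_der F s dF ->
  has_der (fun u => k u *: F u) s (dk *: F s + k s *: dF).
Proof.
move=> Hk /der_row HF; apply/der_row => i.
rewrite (_ : (fun u => _) = (fun u => k u * F u ord0 i)); last first.
  by apply: funext => u; rewrite mxE.
by eapply derEq; [apply: derM Hk (HF i)|rewrite !mxE].
Qed.

Lemma der_dot F G s dF dG : has_der F s dF -> has_der G s dG ->
  has_der (fun u => dot (F u) (G u)) s (dot dF (G s) + dot (F s) dG).
Proof.
move=> /der_row HF /der_row HG; rewrite /dot.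
under [X in has_der X _]eq_fun do rewrite !big_ord_recl big_ord0.
rewrite !big_ord_recl !big_ord0.
have H0 := HF ord0; have G0 := HG ord0.
have H1 := HF (lift ord0 ord0); have G1 := HG (lift ord0 ord0).
have H2 := HF (lift ord0 (lift ord0 ord0)).
have G2 := HG (lift ord0 (lift ord0 ord0)).
der; rewrite !addr0 /=; ring.
Qed.

End VectorCalculus.

Ltac der_step ::=
  first [ eassumption | apply: derI | apply: derC | apply: derCv | apply: derD
        | apply: derN | apply: derM | apply: derX | apply: derV | apply: der_ln
        | apply: der_exp | apply: der_sqrt | apply: derDv | apply: derNv
        | apply: derZv | apply: der_dot ].


(** * Geodesics of the ball model *)

Section Geodesics.
Context {R : realType}.
Local Notation E := 'rV[R]_3.

Lemma has_der0_cst (u : R -> R) : (forall s, has_der u s 0) -> forall s, u s = u 0.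
Proof. by move=> H s; apply: is_derive_0_is_cst => x; exact: H. Qed.

Lemma cvg_expRN_pinfty : expR (- s) @[s --> +oo] --> (0 : R).
Proof. exact: cvgr_expR. Qed.

Lemma cvg_addR (T : Type) (F : set_system T) {FF : Filter F} (f g : T -> R) (a b : R) :
  f x @[x --> F] --> a -> g x @[x --> F] --> b ->
  (f x + g x) @[x --> F] --> (a + b).
Proof. exact: cvgD. Qed.

Lemma cvg_mulR (T : Type) (F : set_system T) {FF : Filter F} (f g : T -> R) (a b : R) :
  f x @[x --> F] --> a -> g x @[x --> F] --> b ->
  (f x * g x) @[x --> F] --> (a * b).
Proof. exact: cvgM. Qed.

Lemma cvg_cstR (T : Type) (F : set_system T) {FF : Filter F} (a : R) :
  a @[_ --> F] --> a.
Proof. exact: (@cvg_cst R). Qed.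

(** [(u + u') exp (- s)] and [(u - u') exp s] are constants of motion of
    [u'' = u]; only the first of them survives at infinity. *)
Lemma hyperbolic_ode_limit (u u1 : R -> R) :
  (forall s, has_der u s (u1 s)) -> (forall s, has_der u1 s (u s)) ->
  expR (- s) * u s @[s --> +oo] --> (u 0 + u1 0) / 2.
Proof.
move=> Hu Hu1.
have Ha s : (u s + u1 s) * expR (- s) = u 0 + u1 0.
  rewrite (has_der0_cst (u := fun s => (u s + u1 s) * expR (- s))).
    by rewrite oppr0 expR0 mulr1.
  by move=> {}s; have H0 := Hu s; have H1 := Hu1 s; der; ring.
have Hb s : (u s - u1 s) * expR s = u 0 - u1 0.
  rewrite (has_der0_cst (u := fun s => (u s - u1 s) * expR s)).
    by rewrite expR0 mulr1.
  by move=> {}s; have H0 := Hu s; have H1 := Hu1 s; der; ring.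
have E s : expR (- s) * u s = (u 0 + u1 0) / 2 +
    (u 0 - u1 0) / 2 * (expR (- s) * expR (- s)).
  rewrite -(Ha s) -(Hb s); have := expRxMexpNx_1 s.
  move: (expR s) (expR (- s)) (u s) (u1 s) => x y p q xy.
  transitivity ((p + q) * y / 2 + (p - q) * (x * y) * y / 2); last by field.
  by rewrite xy; field.
rewrite (_ : (fun s => _) = fun s => (u 0 + u1 0) / 2 +
    (u 0 - u1 0) / 2 * (expR (- s) * expR (- s))); last exact: funext.
have : (u 0 + u1 0) / 2 + (u 0 - u1 0) / 2 * (expR (- s) * expR (- s))
    @[s --> +oo] --> (u 0 + u1 0) / 2 + (u 0 - u1 0) / 2 * (0 * 0 : R).
  apply: cvg_addR; first exact: cvg_cstR.
  apply: cvg_mulR; first exact: cvg_cstR.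
  by apply: cvg_mulR; exact: cvg_expRN_pinfty.
by rewrite !mulr0 addr0.
Qed.

Lemma unit_ball_gt0 (x : E) : unit_ball x -> 0 < 1 - dot x x.
Proof. by rewrite /unit_ball /= subr_gt0. Qed.

(** The initial data determine the endpoint. In the hyperboloid model, with
    coordinates [l - 1] and [l x] for [l = hyp_factor x], a geodesic of unit
    speed satisfies the linear equation [Y'' = Y], because the speed is a
    constant of motion; its direction at infinity is that of the null vector
    [Y 0 + Y' 0], by whose time component the conclusion is multiplied. *)
Lemma geodesic_endpoint (g : R -> E) (p v xi : E) :
  hyp_geodesic g -> g 0 = p -> derive1 g 0 = v -> hyp_dot p v v = 1 ->
  g s @[s --> +oo] --> xi ->
  (hyp_factor p - 1 + hyp_factor p ^+ 2 * dot p v) *: xi =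
  hyp_factor p *: p + (hyp_factor p ^+ 2 * dot p v) *: p + hyp_factor p *: v.
Proof.
move=> Hg g0 g10 v1 gxi.
pose l s := hyp_factor (g s).
pose g1 := derive1 g.
pose c s := l s ^+ 2 * dot (g1 s) (g1 s).
pose l1 s := l s ^+ 2 * dot (g s) (g1 s).
have lb s : 0 < 1 - dot (g s) (g s) by apply: unit_ball_gt0; case: (Hg s).
have Dg s : has_der g s (g1 s) by case: (Hg s) => _ ? _ _; exact: derP.
have Dg1 s : has_der g1 s (- (l s) *: ((2 * dot (g s) (g1 s)) *: g1 s
                                 - dot (g1 s) (g1 s) *: g s)).
  case: (Hg s) => _ _ /derP Dg1 /eqP.
  rewrite /hyp_nabla addr_eq0 => /eqP Eg1.
  apply: derEq Dg1 _; rewrite [LHS]Eg1 -scaleNr; congr (_ *: _).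
  by rewrite -scalerDl -mulr2n mulr_natl.
have Dl s : has_der l s (l1 s).
  have H := Dg s; have n0 : 1 - dot (g s) (g s) != 0 by rewrite gt_eqF.
  rewrite /l1 /l /hyp_factor; der; rewrite (dotC (g1 s)).
  by field.
have lE s : l s * dot (g s) (g s) = l s - 2.
  have n0 : 1 - dot (g s) (g s) != 0 by rewrite gt_eqF.
  by rewrite /l /hyp_factor; field.
have Dc s : has_der c s 0.
  have H1 := Dl s; have H2 := Dg1 s.
  rewrite /c; der; rewrite /= !dotE (dotC (g1 s) (g s)) /l1.
  by ring.
have c1 s : l s ^+ 2 * dot (g1 s) (g1 s) = 1.
  by rewrite -/(c s) (has_der0_cst Dc) /c /l g0 /g1 g10.
have Dl1 s : has_der l1 s (l s - 1).
  have H1 := Dl s; have H2 := Dg1 s; have H3 := Dg s.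
  rewrite /l1; der; rewrite /= !dotE /l1.
  transitivity (l s ^+ 2 * dot (g1 s) (g1 s) * (1 + l s * dot (g s) (g s))).
    by ring.
  by rewrite c1 lE; ring.
have Dl' s : has_der (fun s => l s - 1) s (l1 s).
  by have H := Dl s; der; ring.
have lim1 := hyperbolic_ode_limit Dl' Dl1.
have Lz (i : 'I_3) :
    expR (- s) * (l s * g s ord0 i) @[s --> +oo] -->
      (l 0 * p ord0 i + (l1 0 * p ord0 i + l 0 * v ord0 i)) / 2.
  rewrite -g0 -g10.
  apply: (hyperbolic_ode_limit (u := fun s => l s * g s ord0 i)
    (u1 := fun s => l1 s * g s ord0 i + l s * g1 s ord0 i)) => s.
    have H1 := Dl s; have H2 := (der_row g s (g1 s)).1 (Dg s) i.
    by der.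
  have H1 := Dl s; have H2 := (der_row g s (g1 s)).1 (Dg s) i.
  have H3 := (der_row g1 s _).1 (Dg1 s) i; have H4 := Dl1 s.
  der; rewrite !mxE /l1.
  transitivity ((l s - 1) * g s ord0 i +
     l s ^+ 2 * dot (g1 s) (g1 s) * g s ord0 i); first by ring.
  by rewrite c1; ring.
have lim0 : expR (- s) * l s @[s --> +oo] --> (l 0 - 1 + l1 0) / 2.
  rewrite (_ : (fun s => _) =
    fun s => expR (- s) * (l s - 1) + expR (- s)); last first.
    by apply: funext => s; ring.
  have : expR (- s) * (l s - 1) + expR (- s) @[s --> +oo] -->
      ((l 0 - 1 + l1 0) / 2 + 0).
    by apply: cvg_addR; [exact: lim1|exact: cvg_expRN_pinfty].
  by rewrite addr0.
have -> : hyp_factor p = l 0 by rewrite /l g0.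
have -> : l 0 ^+ 2 * dot p v = l1 0 by rewrite /l1 g0 /g1 g10.
apply/rowP => i; rewrite !mxE.
have gi : g s ord0 i @[s --> +oo] --> xi ord0 i.
  apply: (cvg_comp g (fun M : E => M ord0 i) gxi).
  exact: coord_continuous.
have L2 : expR (- s) * (l s * g s ord0 i) @[s --> +oo] -->
    (l 0 - 1 + l1 0) / 2 * xi ord0 i.
  rewrite (_ : (fun s => _) = fun s => expR (- s) * l s * g s ord0 i).
    by apply: cvg_mulR.
  by apply: funext => s; rewrite mulrA.
have := cvg_unique _ L2 (Lz i).
move=> /(_ (@Rhausdorff R)) H.
transitivity (2 * ((l 0 - 1 + l1 0) / 2 * xi ord0 i)); first by field.
by rewrite H; field.
Qed.

(** In the hyperboloid model the geodesic is
    [(exp s (e, e theta) + exp (- s) (be, b)) / 2] for two null vectors; the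
    hypothesis that [p] lies on the horosphere of height [ln e] makes the first
    one a multiple of [(1, theta)]. *)
Lemma geodesic_to_ideal_point (p theta : E) (e : R) :
  unit_ball p -> dot theta theta = 1 -> 0 < e ->
  e * dot (p - theta) (p - theta) = 1 - dot p p ->
  ideal_endpoint p (((1 - dot p p) / 2) *: (e *: (theta - p) - p)) theta.
Proof.
move=> /unit_ball_gt0 p1 th1 e0 hp.
have n0 : 1 - dot p p != 0 by rewrite gt_eqF.
have en0 : e != 0 by rewrite gt_eqF.
pose l := 2 / (1 - dot p p).
pose be := 2 * (l - 1) - e.
have [b bE] : exists b, b = (2 * l) *: p - e *: theta by eexists.
have hpt : dot p theta = (e * (1 + dot p p) - (1 - dot p p)) / (2 * e).
  move: hp; rewrite !dotE th1 (dotC theta p) => hp.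
  have H : dot p theta * (2 * e) = e * (1 + dot p p) - (1 - dot p p) by lra.
  by rewrite -H mulfK // mulf_neq0 ?pnatr_eq0.
have bb : dot b b = be ^+ 2.
  by rewrite bE /be !dotE (dotC theta p) th1 hpt /l; field; rewrite n0 en0.
have tb : e * dot theta b = e * be - 2.
  by rewrite bE /be !dotE (dotC theta p) th1 hpt /l; field; rewrite n0 en0.
(* Cauchy-Schwarz for theta and b: the null vector (be, b) points to the
   future, since its Minkowski product with (e, e theta) is positive *)
have be0 : 0 < be.
  have := dot_ge0 (b - dot theta b *: theta).
  rewrite !dotE (dotC b theta) th1 bb => H.
  have H1 : 0 <= e ^+ 2 * be ^+ 2 - (e * dot theta b) ^+ 2.
    rewrite exprMn -mulrBr; apply: mulr_ge0; first exact: sqr_ge0.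
    by rewrite !expr2 in H *; lra.
  rewrite tb in H1.
  have : 0 < e * be by lra.
  by rewrite pmulr_rgt0.
pose y s := 1 + (e * expR s + be * expR (- s)) / 2.
pose y1 s := (e * expR s - be * expR (- s)) / 2.
pose z s := (e * expR s / 2) *: theta + (expR (- s) / 2) *: b.
pose z1 s := (e * expR s / 2) *: theta - (expR (- s) / 2) *: b.
have y0 s : 0 < y s.
  have := expR_gt0 s; have := expR_gt0 (- s) => h1 h2.
  have := mulr_gt0 e0 h2; have := mulr_gt0 be0 h1; rewrite /y => *; lra.
have Dy s : has_der y s (y1 s) by rewrite /y /y1; der; field.
have Dy1 s : has_der y1 s (y s - 1) by rewrite /y /y1; der; field.
have Dz s : has_der z s (z1 s).
  by rewrite /z /z1; der; apply/rowP => i; rewrite !mxE; field.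
have Dz1 s : has_der z1 s (z s).
  by rewrite /z /z1; der; apply/rowP => i; rewrite !mxE; field.
have zz s : dot (z s) (z s) = y s ^+ 2 - 2 * y s.
  rewrite /z /y !dotE (dotC b theta) th1 bb; have := expRxMexpNx_1 s.
  move: (expR s) (expR (- s)) => E F EF.
  transitivity ((e ^+ 2 * E ^+ 2 + be ^+ 2 * F ^+ 2 +
                 2 * (e * dot theta b) * (E * F)) / 4); first by field.
  rewrite tb; apply/eqP; rewrite -subr_eq0; apply/eqP.
  transitivity (1 - (E * F)); first by field.
  by rewrite EF subrr.
have zz1 s : dot (z s) (z1 s) = (y s - 1) * y1 s.
  rewrite /z /z1 /y /y1 !dotE (dotC b theta) th1 bb.
  by move: (expR s) (expR (- s)) => E F; field.
have z1z1 s : dot (z1 s) (z1 s) = y1 s ^+ 2 + 1.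
  rewrite /z1 /y1 !dotE (dotC b theta) th1 bb; have := expRxMexpNx_1 s.
  move: (expR s) (expR (- s)) => E F EF.
  transitivity ((e ^+ 2 * E ^+ 2 + be ^+ 2 * F ^+ 2 -
                 2 * (e * dot theta b) * (E * F)) / 4); first by field.
  rewrite tb; apply/eqP; rewrite -subr_eq0; apply/eqP.
  transitivity (E * F - 1); first by field.
  by rewrite EF subrr.
have yE s : y s = 1 + (e * expR s + be * expR (- s)) / 2 by [].
have y1E s : y1 s = (e * expR s - be * expR (- s)) / 2 by [].
have zE s : z s = (e * expR s / 2) *: theta + (expR (- s) / 2) *: b by [].
have z1E s : z1 s = (e * expR s / 2) *: theta - (expR (- s) / 2) *: b by [].
clearbody y y1 z z1.
pose x s := (y s)^-1 *: z s.
pose x1 s := (y s)^-1 *: z1 s - (y1 s / y s ^+ 2) *: z s.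
have Dx s : has_der x s (x1 s).
  have yn : y s != 0 by rewrite gt_eqF.
  have H1 := Dy s; have H2 := Dz s.
  by rewrite /x /x1; der; apply/rowP => i; rewrite !mxE; field.
pose x2 s := (2 * y1 s ^+ 2 / y s ^+ 3 + (y s)^-1 - (y s - 1) / y s ^+ 2) *: z s
  - (2 * y1 s / y s ^+ 2) *: z1 s.
have Dx1 s : has_der x1 s (x2 s).
  have yn : y s != 0 by rewrite gt_eqF.
  have yn2 : y s ^+ 2 != 0 by rewrite expf_neq0.
  have H1 := Dy s; have H2 := Dz s; have H3 := Dy1 s; have H4 := Dz1 s.
  by rewrite /x1 /x2; der; apply/rowP => i; rewrite !mxE; field.
have dx : derive1 x = x1 by apply: funext => s; exact: der_val.
have xx s : dot (x s) (x s) = 1 - 2 / y s.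
  have yn : y s != 0 by rewrite gt_eqF.
  by rewrite /x !dotE zz; field.
have E0 : expR 0 = 1 :> R by exact: expR0.
have yl : y 0 = l by rewrite yE oppr0 E0 /be; field.
have x0 : x 0 = p.
  have ln : l != 0 by rewrite gt_eqF // divr_gt0.
  rewrite /x yl zE oppr0 E0 bE; apply/rowP => i; rewrite !mxE.
  by field.
exists x; split => //.
- move=> s; split.
  + by rewrite /unit_ball /= xx ltrBlDr ltrDl divr_gt0.
  + by case: (Dx s).
  + by rewrite dx; case: (Dx1 s).
  + have yn : y s != 0 by rewrite gt_eqF.
    rewrite /derive1n /= dx (der_val (Dx1 s)) /hyp_nabla.
    have -> : hyp_factor (x s) = y s.
      by rewrite /hyp_factor xx opprB addrC subrK; field.
    have -> : dot (x s) (x1 s) = y1 s / y s ^+ 2.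
      by rewrite /x /x1 !dotE zz zz1; field.
    have -> : dot (x1 s) (x1 s) = (y s) ^- 2.
      by rewrite /x1 !dotE (dotC (z1 s)) zz zz1 z1z1; field.
    by rewrite /x /x1 /x2; apply/rowP => i; rewrite !mxE; field.
- rewrite dx /x1 yl y1E z1E zE oppr0 E0 bE /be /l; apply/rowP => i; rewrite !mxE.
  by field.
- pose D (s : R) : R := expR (- s) + (e + be * (expR (- s) * expR (- s))) / 2.
  have yD s : y s = expR s * D s.
    rewrite /D yE; have := expRxMexpNx_1 s.
    move: (expR s) (expR (- s)) => E F EF.
    transitivity (E * F + (e * E + be * F * (E * F)) / 2); last by field.
    by rewrite EF; field.
  have Dlim : D s @[s --> +oo] --> e / 2.
    have : D s @[s --> +oo] --> (0 + (e + be * (0 * 0)) / 2 : R).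
      rewrite /D; apply: cvg_addR; first exact: cvg_expRN_pinfty.
      apply: cvg_mulR; last exact: cvg_cstR.
      apply: cvg_addR; first exact: cvg_cstR.
      apply: cvg_mulR; first exact: cvg_cstR.
      by apply: cvg_mulR; exact: cvg_expRN_pinfty.
    by rewrite !mulr0 addr0 add0r.
  have Dilim : (D s)^-1 @[s --> +oo] --> (e / 2)^-1.
    by apply: cvgV => //; rewrite gt_eqF // divr_gt0.
  have xE s : x s = (e / 2 * (D s)^-1) *: theta +
      (expR (- s) * expR (- s) / 2 * (D s)^-1) *: b.
    have Dn : D s != 0.
      by apply/eqP => D0; move: (y0 s); rewrite yD D0 mulr0 ltxx.
    have En : expR s != 0 by rewrite gt_eqF // expR_gt0.
    rewrite /x yD zE expRN; move: Dn En; move: (D s) (expR s) => Ds Es Dn En.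
    by apply/rowP => i; rewrite !mxE; field; rewrite Dn.
  have : (e / 2 * (D s)^-1) *: theta +
      (expR (- s) * expR (- s) / 2 * (D s)^-1) *: b @[s --> +oo] -->
      (e / 2 * (e / 2)^-1) *: theta + (0 * 0 / 2 * (e / 2)^-1) *: b.
    apply: cvgD; apply: cvgZr_tmp; apply: cvg_mulR => //; first exact: cvg_cstR.
    apply: cvg_mulR; last exact: cvg_cstR.
    by apply: cvg_mulR; exact: cvg_expRN_pinfty.
  have e2 : e / 2 != 0 by rewrite gt_eqF // divr_gt0.
  rewrite divff // !mul0r scale1r scale0r addr0.
  by under [X in _ -> X]eq_cvg do rewrite xE.
Qed.

(** The inward unit normal of a horosphere points to its base point; this is
    the statement that the Gauss map of the envelope inverts [R_map]. *)
Lemma ideal_endpoint_horosphere (p theta xi : E) (e : R) :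
  unit_ball p -> dot theta theta = 1 -> 0 < e ->
  e * dot (p - theta) (p - theta) = 1 - dot p p ->
  ideal_endpoint p (((1 - dot p p) / 2) *: (e *: (theta - p) - p)) xi <->
  xi = theta.
Proof.
move=> p1 th1 e0 hp; split=> [[g [Hg g0 g10 gxi]]|->]; last first.
  exact: geodesic_to_ideal_point.
have n0 : 1 - dot p p != 0 by rewrite gt_eqF // unit_ball_gt0.
have en0 : e != 0 by rewrite gt_eqF.
have hpt : dot p theta = (e * (1 + dot p p) - (1 - dot p p)) / (2 * e).
  move: hp; rewrite !dotE th1 (dotC theta p) => hp.
  have H : dot p theta * (2 * e) = e * (1 + dot p p) - (1 - dot p p) by lra.
  by rewrite -H mulfK // mulf_neq0 ?pnatr_eq0.
have := geodesic_endpoint Hg g0 g10 _ gxi.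
set v := _ *: _.
have -> : hyp_factor p ^+ 2 * dot p v = e + 1 - hyp_factor p.
  by rewrite /v /hyp_factor !dotE hpt; field; rewrite en0 n0.
have -> : hyp_factor p - 1 + (e + 1 - hyp_factor p) = e by ring.
have -> : hyp_factor p *: p + (e + 1 - hyp_factor p) *: p + hyp_factor p *: v =
    e *: theta.
  by rewrite /v /hyp_factor; apply/rowP => i; rewrite !mxE; field.
move=> H; apply: (scalerI en0); apply: H.
rewrite /hyp_dot /hyp_factor /v !dotE th1 (dotC theta p) hpt.
by field; rewrite en0 n0.
Qed.

End Geodesics.

(** * The envelope of horospheres at a point *)

Section Envelope.
Context {R : realType}.
Local Notation E := 'rV[R]_3.
Implicit Types (th D P v w x y : E) (e : R).

Definition refl P y : E := y - (2 * dot P y / dot P P) *: P.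

(** [R_map rho theta = theta + 2 P / |P|^2] for the vector
    [P = D rho - (exp rho + 1) theta]: the envelope is an inversion of the point
    [P], so its differential is a reflection up to scale. *)
Definition envelope th P : E := th + (2 / dot P P) *: P.

(** Minus the hyperbolic gradient of the Busemann function at [th], at a point
    of the horosphere of height [ln e]. *)
Definition horo_normal th e x : E :=
  ((1 - dot x x) / 2) *: (e *: (th - x) - x).

Lemma refl_lin P k y : refl P (k *: y) = k *: refl P y.
Proof. by apply/rowP => i; rewrite /refl dotZr !mxE; ring. Qed.

Lemma dot_refl P v w : dot P P != 0 -> dot (refl P v) (refl P w) = dot v w.
Proof. by move=> P0; rewrite /refl !dotE (dotC v P); field. Qed.

Lemma refl_eq0 P v : dot P P != 0 -> refl P v = 0 -> v = 0.
Proof.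
by move=> P0 H; apply: dot_eq0; rewrite -(dot_refl v v P0) H dot0l.
Qed.

Lemma refl_invol P y : dot P P != 0 -> refl P (refl P y) = y.
Proof.
by move=> P0; apply/rowP => i; rewrite /refl !dotE !mxE; field.
Qed.

Lemma dot_refl_adj P v w : dot v (refl P w) = dot (refl P v) w.
Proof. by rewrite /refl !dotE (dotC v P); ring. Qed.

Section Point.
Variables (th P : E) (e : R).
Hypotheses (th1 : dot th th = 1) (Pth : dot P th = - (e + 1)) (e0 : 0 < e).
Local Notation d := (dot P P).
Local Notation x := (envelope th P).

Lemma axis_neq0 : d != 0.
Proof.
apply/eqP => /dot_eq0 P0; move: Pth; rewrite P0 dot0l => /eqP.
by rewrite eq_sym oppr_eq0 gt_eqF // addr_gt0.
Qed.

Lemma axis_gt0 : 0 < d.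
Proof. by rewrite lt0r axis_neq0 dot_ge0. Qed.

Lemma envelope_norm : 1 - dot x x = 4 * e / d.
Proof.
have := axis_neq0; rewrite /envelope !dotE (dotC th) Pth th1 => d0.
by field.
Qed.

Lemma envelope_ball : unit_ball x.
Proof.
by rewrite /unit_ball /= -subr_gt0 envelope_norm divr_gt0 ?axis_gt0 // mulr_gt0.
Qed.

Lemma envelope_horosphere : e * dot (x - th) (x - th) = 1 - dot x x.
Proof.
rewrite envelope_norm /envelope addrC addKr !dotE.
by have := axis_neq0 => d0; field.
Qed.

(** The reflection that carries the tangent plane of the sphere at [th] to the
    tangent plane of the envelope carries [th] to the normal. *)
Lemma horo_normalE : horo_normal th e x = - (2 * e / d) *: refl P th.
Proof.
have := axis_neq0 => d0.
rewrite /horo_normal envelope_norm /refl Pth /envelope.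
move: (dot P P) d0 => axis_sq d0.
by apply/rowP => i; rewrite !mxE; field.
Qed.

Lemma hyp_factor_envelope : hyp_factor x = d / (2 * e).
Proof.
rewrite /hyp_factor envelope_norm.
have := axis_neq0 => d0; have en0 : e != 0 by rewrite gt_eqF.
by rewrite invf_div mulrA; field.
Qed.

(** The condition that selects the sign of the normal: along the opposite
    normal the defect of the horoball inequality grows at first order. *)
Lemma anti_normal_not_inward n s : 0 < s -> 0 < dot n n ->
  n = - horo_normal th e x ->
  ~ e * dot (x + s *: n - th) (x + s *: n - th) < 1 - dot (x + s *: n) (x + s *: n).
Proof.
move=> s0 nn nE; have hs := envelope_horosphere; have x1 := envelope_norm.
have d0 := axis_gt0.
have X0 : 0 < 1 - dot x x by rewrite x1 divr_gt0 // mulr_gt0.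
have en : (1 - dot x x) * (e * dot n th - (e + 1) * dot n x) = - (2 * dot n n).
  rewrite {4}nE /horo_normal dotNr dotZr.
  by move: (envelope th P) => y; rewrite !dotE; field.
move: (envelope th P) hs X0 en => y hs X0 en; rewrite !dotE => H.
rewrite !dotE in hs.
have : (1 - dot y y) * (2 * s * ((e + 1) * dot n y - e * dot n th)
         + s ^+ 2 * (e + 1) * dot n n) < 0.
  rewrite pmulr_rlt0 //.
  by move: H hs; rewrite (dotC th n) (dotC y n) (dotC y th); lra.
have -> : (1 - dot y y) * (2 * s * ((e + 1) * dot n y - e * dot n th)
         + s ^+ 2 * (e + 1) * dot n n) =
   - (2 * s) * ((1 - dot y y) * (e * dot n th - (e + 1) * dot n y)) +
   (1 - dot y y) * (s ^+ 2 * (e + 1) * dot n n) by ring.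
rewrite en ltNge => /negP; apply; apply: addr_ge0.
  by rewrite mulrNN !mulr_ge0 ?ltW.
apply: mulr_ge0; first exact: ltW.
apply: mulr_ge0; last exact: ltW.
by apply: mulr_ge0; [exact: sqr_ge0|rewrite addr_ge0 // ltW].
Qed.

(** With [Mv], [Mw] the images of [v], [w] under the shape operator,
    [X] and [Y] are the differentials of the envelope and [dN] that of its
    normal. Modulo the normal, the covariant derivative of the normal along [X]
    is [- X] plus [(e v + r x) / hyp_factor x], and the reflection turns
    [e v + r x] into [e v] plus a multiple of [th]. *)
Lemma second_form_envelope v Mv Mw r :
  dot P v = r -> dot th v = 0 -> dot th Mv = 0 -> dot th Mw = 0 ->
  let X := (2 / d) *: refl P Mv in
  let Y := (2 / d) *: refl P Mw in
  let dN := - dot x X *: (e *: (th - x) - x) +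
    ((1 - dot x x) / 2) *: ((e * r) *: (th - x) + e *: (v - X) - X) in
  - hyp_dot x (hyp_nabla x X (horo_normal th e x) dN) Y =
  dot Mv Mw / e ^+ 2 - dot v Mw.
Proof.
move=> Pv tv tMv tMw X Y dN.
have d0 := axis_neq0; have en0 : e != 0 by rewrite gt_eqF.
rewrite /hyp_dot /hyp_nabla hyp_factor_envelope /horo_normal {}/dN.
rewrite envelope_norm /X /Y /refl /envelope.
have d2 : dot P P / (2 * e) != 0 by rewrite mulf_neq0 ?invr_eq0 ?mulf_neq0.
rewrite !dotE (dotC th P) ?(dotC v P) ?(dotC Mv P) ?(dotC v th).
rewrite ?(dotC Mv th) ?(dotC Mw th) ?(dotC Mw v) ?(dotC Mw Mv) ?(dotC Mv v).
rewrite ?tMv ?tMw ?tv ?Pv Pth th1.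
by field; rewrite d0 en0.
Qed.

End Point.

(** The vector inside the reflection is the shape operator applied to [dth];
    its component along [th] vanishes for the [P] of interest. *)
Lemma der_envelope (th P : R -> E) s dth dP :
  has_der th s dth -> has_der P s dP -> dot (P s) (P s) != 0 ->
  has_der (fun u => envelope (th u) (P u)) s
    ((2 / dot (P s) (P s)) *: refl (P s)
       ((dot (P s) (P s) / 2) *: dth - dot (P s) dth *: P s + dP)).
Proof.
move=> Hth HP P0; rewrite /envelope; der.
rewrite /refl !dotE (dotC dP).
by apply/rowP => i; rewrite !mxE; field.
Qed.

Lemma der_horo_normal (th x : R -> E) (e : R -> R) s dth dx r :
  has_der th s dth -> has_der x s dx -> has_der e s (e s * r) ->
  has_der (fun u => horo_normal (th u) (e u) (x u)) s
    (- dot (x s) dx *: (e s *: (th s - x s) - x s) +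
     ((1 - dot (x s) (x s)) / 2) *:
       ((e s * r) *: (th s - x s) + e s *: (dth - dx) - dx)).
Proof.
move=> Hth Hx He; rewrite /horo_normal; der.
rewrite (dotC dx).
by apply/rowP => i; rewrite !mxE; field.
Qed.

End Envelope.

Section IntrinsicShape.
Context {R : realType}.
Local Notation E := 'rV[R]_3.
Variables (rhoO : E -> R) (t : R).
Local Notation rho := (fun th => rhoO th + t).

(** The differential of [R_map rho] with the reflection and the scale undone:
    the self-adjoint operator [Hess rho - D rho (x) D rho + c Id] of the tangent
    plane of the sphere. It is written without charts because the sign of the
    quadratic differential has to be compared between different charts. *)
Definition shape_op (th v : E) : E :=
  let P := sgrad rho th - (expR (rho th) + 1) *: th in
  (dot P P / 2) *: refl P (sdiff (R_map rho) th v).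

(** Vectors normal to the sphere are killed by [sdiff], so the sum over the
    standard basis is the trace of [shape_op] on the tangent plane. *)
Definition tracefree (th v : E) : R :=
  dot (shape_op th v) v -
  2^-1 * (\sum_(i < 3) shape_op th (delta_mx ord0 i) ord0 i) * dot v v.

End IntrinsicShape.

(** * Complex differentiation along real curves *)

Lemma derivable_caratheodory (K : numFieldType) (h : K^o -> K^o) (z : K^o) :
  derivable h z 1 ->
  exists phi : K^o -> K^o, [/\ forall w, h w - h z = phi w * (w - z),
    phi z = derive1 h z & {for z, continuous phi}].
Proof.
move=> Hd.
pose phi (w : K^o) : K^o := if w == z then derive1 h z else (h w - h z) / (w - z).
have phiz : phi z = derive1 h z by rewrite /phi eqxx.
exists phi; split; [|exact: phiz|].
- move=> w; rewrite /phi; case: eqP => [->|/eqP]; first by rewrite !subrr mulr0.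
  by rewrite -subr_eq0 => /divfK ->.
- have F1 : (fun k : K => k^-1 *: ((h \o shift z) (k *: (1 : K^o)) - h z)) @ 0^' -->
    derive1 h z by rewrite derive1E; exact: Hd.
  apply/continuous_withinNshiftx; rewrite phiz.
  apply: cvg_trans F1; apply: near_eq_cvg.
  near=> i.
  have i0 : i != 0 by near: i; exact: nbhs_dnbhs_neq.
  rewrite /phi /= ifN; last first.
    by rewrite -subr_eq0 addrK.
  by rewrite addrK [RHS]mulrC [i%:A]mulr1.
Unshelve. all: by end_near. Qed.

Lemma derivable_div (K : numFieldType) (u v : K^o -> K^o) (z : K^o) :
  v z != 0 -> derivable u z 1 -> derivable v z 1 ->
  derivable (fun w => u w / v w) z 1 /\
  derive1 (fun w => u w / v w) z =
    (derive1 u z * v z - u z * derive1 v z) / v z ^+ 2.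
Proof.
move=> v0 du dv; have dv1 : derivable (fun w => (v w)^-1) z 1 by exact: derivableV.
have dq : derivable (u * (fun w => (v w)^-1)) z 1 by exact: derivableM.
split; first exact: dq.
rewrite !derive1E (_ : (fun w => u w / v w) = u * (fun w => (v w)^-1)) //.
rewrite deriveM // deriveV //.
move: ('D_1 u z) ('D_1 v z) => p q; rewrite /GRing.scale /=.
by field.
Qed.

Lemma derivable_wronskian (K : numFieldType) (u v w : K^o -> K^o) (z : K^o) :
  derivable u z 1 -> derivable v z 1 -> derivable w z 1 ->
  derivable (fun y => u y * v y - w y * w y) z 1.
Proof.
move=> du dv dw; have d1 : derivable (u * v) z 1 by exact: derivableM.
have d2 : derivable (w * w) z 1 by exact: derivableM.
exact: (derivableB d1 d2).
Qed.

Lemma derivable_sqr (K : numFieldType) (v : K^o -> K^o) (z : K^o) :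
  derivable v z 1 -> derivable (fun y => v y ^+ 2) z 1.
Proof. by move=> dv; exact: (derivableM dv dv). Qed.

Section ComplexChainRule.
Context {R : realType}.
Local Notation C := (R[i])^o.
Local Notation Re := (@complex.Re R).
Local Notation Im := (@complex.Im R).

Lemma normRe_le (z : C) : `|Re z| <= ComplexField.Normc.normc z.
Proof. by have := normc_ge_Re z; rewrite lecR. Qed.

Lemma normIm_le (z : C) : `|Im z| <= ComplexField.Normc.normc z.
Proof.
case: z => a b /=.
by rewrite -[leLHS]sqrtr_sqr ler_wsqrtr // lerDr sqr_ge0.
Qed.

Lemma normc_le (z : C) : ComplexField.Normc.normc z <= `|Re z| + `|Im z|.
Proof.
case: z => a b /=.
rewrite -[leRHS]ger0_norm ?addr_ge0 // -sqrtr_sqr ler_wsqrtr //.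
rewrite sqrrD !real_normK ?num_real // -addrA [X in _ <= _ + X]addrC lerD2l.
by rewrite lerDl mulrn_wge0 // mulr_ge0.
Qed.

Lemma der_continuous_mul (k g : R -> R) s dg :
  {for s, continuous k} -> has_der g s dg -> g s = 0 ->
  has_der (fun u => k u * g u) s (k s * dg).
Proof.
move=> half_laplacian /is_derive1_caratheodory [q [gq rho_y <-]] gs0.
apply/is_derive1_caratheodory; exists (fun u => k u * q u); split => //.
- by move=> u; rewrite gs0 mulr0 subr0 -mulrA -gq gs0 subr0.
- exact: (@cvgM R _ (nbhs s) _ k q).
Qed.

Lemma continuous_Re_Im_comp (phi : C -> C) (a b : R -> R) s :
  {for (a s +i* b s)%C : C, continuous phi} ->
  {for s, continuous a} -> {for s, continuous b} ->
  {for s, continuous (fun u => Re (phi (a u +i* b u)%C))} /\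
  {for s, continuous (fun u => Im (phi (a u +i* b u)%C))}.
Proof.
move=> cphi ca cb.
have H (e : R) : 0 < e -> \forall u \near s,
    ComplexField.Normc.normc (phi (a s +i* b s)%C - phi (a u +i* b u)%C) < e.
  move=> e0; have e0' : (0 : R[i]) < e%:C%C by rewrite ltcR.
  have /cvgrPdist_lt /(_ _ e0') /nbhs_ballP [/= d d0 Hd] := cphi.
  have [dr dE] : exists dr, d = dr%:C%C.
    exists (Re d); case: d d0 {Hd} => p q /=; rewrite ltcE /= => /andP [/eqP -> _].
    by [].
  have dr0 : 0 < dr by move: d0; rewrite dE ltcR.
  have d20 : 0 < dr / 2 by rewrite divr_gt0.
  have /cvgrPdist_lt /(_ _ d20) Ha := ca.
  have /cvgrPdist_lt /(_ _ d20) Hb := cb.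
  near=> u; rewrite -ltcR; apply: Hd.
  rewrite /ball /= dE ltcR; apply: (le_lt_trans (normc_le _)) => /=.
  rewrite [ltRHS](splitr dr); apply: ltrD; [near: u; exact: Ha|near: u; exact: Hb].
split; apply/cvgrPdist_lt => e /H; apply: filterS => u; apply: le_lt_trans.
- have := normRe_le (phi (a s +i* b s)%C - phi (a u +i* b u)%C).
  by case: (phi _) => ? ?; case: (phi _).
- have := normIm_le (phi (a s +i* b s)%C - phi (a u +i* b u)%C).
  by case: (phi _) => ? ?; case: (phi _).
Unshelve. all: by end_near. Qed.

(** Every derivative on the sphere is a derivative along a curve, so this chain
    rule is the only link that is needed between complex and real
    differentiability. It follows from Caratheodory's form
    [h w - h z = phi w * (w - z)] with [phi] continuous at [z]. *)
Lemma der_comp_complex (h : C -> C) (a b : R -> R) s da db (z : C) :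
  derivable h z 1 -> has_der a s da -> has_der b s db -> z = (a s +i* b s)%C ->
  has_der (fun u => Re (h (a u +i* b u)%C)) s (Re (derive1 h z * (da +i* db)%C)) /\
  has_der (fun u => Im (h (a u +i* b u)%C)) s (Im (derive1 h z * (da +i* db)%C)).
Proof.
move=> /derivable_caratheodory [phi [hphi phiz cphi]] Ha Hb zE.
rewrite {}zE in hphi phiz cphi *.
have [cr ci] := continuous_Re_Im_comp cphi (der_cont Ha) (der_cont Hb).
have Ha' : has_der (fun u => a u - a s) s da by der; ring.
have Hb' : has_der (fun u => b u - b s) s db by der; ring.
have Kra := der_continuous_mul cr Ha' (subrr _).
have Kib := der_continuous_mul ci Hb' (subrr _).
have Krb := der_continuous_mul cr Hb' (subrr _).
have Kia := der_continuous_mul ci Ha' (subrr _).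
have hE u : h (a u +i* b u)%C = h (a s +i* b s)%C +
   phi (a u +i* b u)%C * ((a u - a s) +i* (b u - b s))%C.
  by rewrite -[LHS](subrK (h (a s +i* b s)%C)) hphi addrC.
rewrite -phiz; split.
- rewrite (_ : (fun u => _) = fun u => Re (h (a s +i* b s)%C) +
    (Re (phi (a u +i* b u)%C) * (a u - a s) -
     Im (phi (a u +i* b u)%C) * (b u - b s))); last first.
    apply: funext => u; rewrite hE; case: (h _) => ? ?.
    by case: (phi _).
  by der; case: (phi _) => ? ? /=; ring.
- rewrite (_ : (fun u => _) = fun u => Im (h (a s +i* b s)%C) +
    (Re (phi (a u +i* b u)%C) * (b u - b s) +
     Im (phi (a u +i* b u)%C) * (a u - a s))); last first.
    apply: funext => u; rewrite hE; case: (h _) => ? ?.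
    by case: (phi _).
  by der; case: (phi _) => ? ? /=; ring.
Qed.

End ComplexChainRule.

Section ComplexParts.
Context {R : realType}.
Local Notation C := (R[i])^o.
Local Notation Re := (@complex.Re R).
Local Notation Im := (@complex.Im R).
Implicit Types (x y : C).

Lemma ReM x y : Re (x * y) = Re x * Re y - Im x * Im y.
Proof. by case: x => ? ?; case: y. Qed.

Lemma ImM x y : Im (x * y) = Re x * Im y + Im x * Re y.
Proof. by case: x => ? ?; case: y. Qed.

Lemma Re_half : Re 2^-1 = 2^-1.
Proof. by rewrite /= !addr0; field. Qed.

Lemma Im_half : Im 2^-1 = 0.
Proof. by rewrite /= !addr0 mul0r oppr0. Qed.

Lemma complex_neq0 x : x != 0 -> 0 < Re x ^+ 2 + Im x ^+ 2.
Proof.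
case: x => a b; rewrite eq_complex /= negb_and => H.
rewrite lt0r addr_ge0 ?sqr_ge0 // andbT paddr_eq0 ?sqr_ge0 //.
by rewrite !sqrf_eq0 negb_and.
Qed.

End ComplexParts.


(** * Stereographic charts *)

Section Chart.
Context {R : realType}.
Local Notation E := 'rV[R]_3.
Implicit Types (A : 'M[R]_3) (u v w : E) (a b c x y s : R).

Definition frame A a b c : E := vec3 a b c *m A.

Lemma vec3E a b c : vec3 a b c =
  a *: vec3 1 0 0 + b *: vec3 0 1 0 + c *: vec3 0 0 1.
Proof.
by apply/rowP => i; rewrite !mxE; case: i => [[|[|[|]]]] //= _; ring.
Qed.

Lemma frameE A a b c :
  frame A a b c = a *: frame A 1 0 0 + b *: frame A 0 1 0 + c *: frame A 0 0 1.
Proof. by rewrite /frame vec3E !mulmxDl -!scalemxAl. Qed.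

Lemma frameD A a b c a' b' c' :
  frame A a b c + frame A a' b' c' = frame A (a + a') (b + b') (c + c').
Proof.
rewrite /frame -mulmxDl; congr (_ *m _).
by apply/rowP => i; rewrite !mxE; case: i => [[|[|[|]]]].
Qed.

Lemma frameZ A k a b c : k *: frame A a b c = frame A (k * a) (k * b) (k * c).
Proof.
rewrite /frame scalemxAl; congr (_ *m _).
by apply/rowP => i; rewrite !mxE; case: i => [[|[|[|]]]].
Qed.

Lemma frameN A a b c : - frame A a b c = frame A (- a) (- b) (- c).
Proof. by rewrite -scaleN1r frameZ !mulN1r. Qed.

Lemma dot_mx u v : dot u v = (u *m v^T) ord0 ord0.
Proof. by rewrite mxE; apply: eq_bigr => i _; rewrite mxE. Qed.

Lemma dot_frame A a b c a' b' c' : rotation A ->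
  dot (frame A a b c) (frame A a' b' c') = a * a' + b * b' + c * c'.
Proof.
case=> AA _; rewrite dot_mx /frame trmx_mul -mulmxA (mulmxA A) AA mul1mx -dot_mx.
by rewrite /dot !big_ord_recl big_ord0 !mxE /=; ring.
Qed.

Lemma frame_coord A u : rotation A ->
  u = frame A (dot u (frame A 1 0 0)) (dot u (frame A 0 1 0)) (dot u (frame A 0 0 1)).
Proof.
case=> AA dA.
have [a [b [c ->]]] : exists a b c, u = frame A a b c.
  pose w := u *m A^T; exists (w ord0 ord0), (w ord0 (lift ord0 ord0)).
  exists (w ord0 (lift ord0 (lift ord0 ord0))).
  rewrite -[LHS](mulmx1) -(mulmx1C AA) mulmxA -/w /frame; congr (_ *m _).
  have wE (i j : 'I_3) : val i = val j -> w ord0 i = w ord0 j by move/val_inj->.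
  by apply/rowP => i; rewrite [RHS]mxE; case: i => [[|[|[|]]]] //= ?; exact: wE.
rewrite !dot_frame //; congr frame; ring.
Qed.

Lemma der_frame A (a b c : R -> R) s da db dc :
  has_der a s da -> has_der b s db -> has_der c s dc ->
  has_der (fun t => frame A (a t) (b t) (c t)) s (frame A da db dc).
Proof.
move=> Ha Hb Hc.
rewrite (_ : (fun t => _) = fun t => a t *: frame A 1 0 0 + b t *: frame A 0 1 0 +
  c t *: frame A 0 0 1); last by apply: funext => t; exact: frameE.
by der; rewrite [RHS]frameE !scaler0 !addr0.
Qed.

(** The gradients on the sphere, as functions of the chart coordinates, of the
    chart coordinates themselves; they are polynomial and, up to the factor
    [metric], equal to the coordinate vector fields. *)
Definition grad_re A x y := frame A ((1 - x ^+ 2 + y ^+ 2) / 2) (- (x * y)) x.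
Definition grad_im A x y := frame A (- (x * y)) ((1 + x ^+ 2 - y ^+ 2) / 2) y.
Definition chart A x y := stereo A (x +i* y)%C.
Definition metric x y := 4 / (1 + x ^+ 2 + y ^+ 2) ^+ 2.

Lemma den_gt0 x y : 0 < 1 + x ^+ 2 + y ^+ 2.
Proof. by rewrite -addrA ltr_wpDr ?addr_ge0 ?sqr_ge0. Qed.

Lemma den_neq0 x y : 1 + x ^+ 2 + y ^+ 2 != 0.
Proof. by rewrite gt_eqF // den_gt0. Qed.

Lemma metric_gt0 x y : 0 < metric x y.
Proof. by rewrite /metric divr_gt0 // exprn_gt0 // den_gt0. Qed.

Lemma chartE A x y : chart A x y =
  frame A (2 * x / (1 + x ^+ 2 + y ^+ 2)) (2 * y / (1 + x ^+ 2 + y ^+ 2))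
       ((x ^+ 2 + y ^+ 2 - 1) / (1 + x ^+ 2 + y ^+ 2)).
Proof.
rewrite /chart /stereo /frame /= addrA; congr (_ *m _).
by apply/rowP => i; rewrite !mxE; case: i => [[|[|[|]]]] //= _; rewrite mulrC.
Qed.

Section Rot.
Variable A : 'M[R]_3.
Hypothesis rA : rotation A.

Lemma chart_sphere x y : dot (chart A x y) (chart A x y) = 1.
Proof. by rewrite chartE dot_frame //; have := den_neq0 x y => ?; field. Qed.

Lemma dot_chart_grad_re x y : dot (chart A x y) (grad_re A x y) = 0.
Proof. by rewrite chartE dot_frame //; have := den_neq0 x y => ?; field. Qed.

Lemma dot_chart_grad_im x y : dot (chart A x y) (grad_im A x y) = 0.
Proof. by rewrite chartE dot_frame //; have := den_neq0 x y => ?; field. Qed.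

Lemma grad_re_sq x y : dot (grad_re A x y) (grad_re A x y) = (metric x y)^-1.
Proof. by rewrite dot_frame // /metric invf_div; field. Qed.

Lemma grad_im_sq x y : dot (grad_im A x y) (grad_im A x y) = (metric x y)^-1.
Proof. by rewrite dot_frame // /metric invf_div; field. Qed.

Lemma dot_grad_re_im x y : dot (grad_re A x y) (grad_im A x y) = 0.
Proof. by rewrite dot_frame //; field. Qed.

Lemma chart_decomp x y v : v =
  metric x y *: (dot (grad_re A x y) v *: grad_re A x y +
                 dot (grad_im A x y) v *: grad_im A x y) +
  dot (chart A x y) v *: chart A x y.
Proof.
rewrite [v](frame_coord _ rA); move: (dot v _) (dot v _) (dot v _) => a b c.
rewrite chartE /grad_re /grad_im !dot_frame // !(frameZ, frameD) /metric.
by have := den_neq0 x y => ?; congr frame; field.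
Qed.

Lemma der_chart (a b : R -> R) s da db : has_der a s da -> has_der b s db ->
  has_der (fun t => chart A (a t) (b t)) s
    (metric (a s) (b s) *: (da *: grad_re A (a s) (b s) + db *: grad_im A (a s) (b s))).
Proof.
move=> Ha Hb; have d0 := den_neq0 (a s) (b s).
rewrite (_ : (fun t => _) = fun t =>
  frame A (2 * a t / (1 + a t ^+ 2 + b t ^+ 2)) (2 * b t / (1 + a t ^+ 2 + b t ^+ 2))
    ((a t ^+ 2 + b t ^+ 2 - 1) / (1 + a t ^+ 2 + b t ^+ 2))); last first.
  by apply: funext => t; exact: chartE.
eapply derEq; first by apply: der_frame; repeat der_step.
cbv beta; rewrite /grad_re /grad_im !(frameZ, frameD) /metric.
by congr frame; field.
Qed.

Lemma stereo_diffE x y a b : stereo_diff A (x +i* y)%C (a +i* b)%C =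
  metric x y *: (a *: grad_re A x y + b *: grad_im A x y).
Proof.
rewrite /stereo_diff; apply: der_val.
rewrite (_ : (fun s : R => _) = fun s => chart A (x + s * a) (y + s * b)); last first.
  apply: funext => s; rewrite /chart; congr (stereo A _); apply/eqP.
  by rewrite eq_complex /= !mul0r subr0 addr0 !eqxx.
have Ha : has_der (fun s => x + s * a) 0 a by der; ring.
have Hb : has_der (fun s => y + s * b) 0 b by der; ring.
by have := der_chart Ha Hb; rewrite !mul0r !addr0.
Qed.

(** Inverse of [chart A] away from the pole, the third row of [A]. *)
Definition chart_re u := dot u (frame A 1 0 0) / (1 - dot u (frame A 0 0 1)).
Definition chart_im u := dot u (frame A 0 1 0) / (1 - dot u (frame A 0 0 1)).

Lemma chart_not_pole x y : 1 - dot (chart A x y) (frame A 0 0 1) != 0.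
Proof.
rewrite chartE dot_frame // !(mulr0, mulr1, add0r, addr0).
have -> : 1 - (x ^+ 2 + y ^+ 2 - 1) / (1 + x ^+ 2 + y ^+ 2) =
   2 / (1 + x ^+ 2 + y ^+ 2) by have := den_neq0 x y => ?; field.
by rewrite gt_eqF // divr_gt0 // den_gt0.
Qed.

Lemma chart_reK x y : chart_re (chart A x y) = x.
Proof.
apply: (canLR (mulfK (chart_not_pole x y))).
by rewrite chartE !dot_frame //; have := den_neq0 x y => ?; field.
Qed.

Lemma chart_imK x y : chart_im (chart A x y) = y.
Proof.
apply: (canLR (mulfK (chart_not_pole x y))).
by rewrite chartE !dot_frame //; have := den_neq0 x y => ?; field.
Qed.

Lemma chartK u : dot u u = 1 -> 1 - dot u (frame A 0 0 1) != 0 ->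
  chart A (chart_re u) (chart_im u) = u.
Proof.
rewrite [u](frame_coord _ rA) /chart_re /chart_im !dot_frame // chartE.
move: (dot u (frame A 1 0 0)) (dot u (frame A 0 1 0)) (dot u (frame A 0 0 1)) => a b c.
rewrite !(mulr0, mulr1, add0r, addr0) => n1 c1.
have dE : 1 + (a / (1 - c)) ^+ 2 + (b / (1 - c)) ^+ 2 = 2 / (1 - c).
  transitivity (1 + (a * a + b * b + c * c - c * c) / (1 - c) ^+ 2).
    by field.
  by rewrite n1; field.
have -> : (a / (1 - c)) ^+ 2 + (b / (1 - c)) ^+ 2 - 1 = 2 / (1 - c) - 2.
  by rewrite -dE; ring.
rewrite dE; congr frame.
- by rewrite invf_div; field.
- by rewrite invf_div; field.
- by rewrite invf_div; field.
Qed.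

(** The two sides agree only modulo the equation of the sphere and its
    derivative along the curve, which are substituted by hand. *)
Lemma der_chart_coords (w : R -> E) s dw : has_der w s dw -> dot (w s) (w s) = 1 ->
  1 - dot (w s) (frame A 0 0 1) != 0 -> dot (w s) dw = 0 ->
  has_der (fun t => chart_re (w t)) s (dot (grad_re A (chart_re (w s)) (chart_im (w s))) dw) /\
  has_der (fun t => chart_im (w t)) s (dot (grad_im A (chart_re (w s)) (chart_im (w s))) dw).
Proof.
move=> Hw w1 wn wd.
have Hp := der_dot Hw (derCv (frame A 1 0 0) s).
have Hq := der_dot Hw (derCv (frame A 0 1 0) s).
have Hr := der_dot Hw (derCv (frame A 0 0 1) s).
rewrite (dotC _ 0) dot0l addr0 in Hp; rewrite (dotC _ 0) dot0l addr0 in Hq.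
rewrite (dotC _ 0) dot0l addr0 in Hr.
have wE := frame_coord (w s) rA; have dE := frame_coord dw rA.
set p := dot (w s) (frame A 1 0 0) in wE; set q := dot (w s) (frame A 0 1 0) in wE.
set r := dot (w s) (frame A 0 0 1) in wE wn.
set p1 := dot dw (frame A 1 0 0) in Hp dE; set q1 := dot dw (frame A 0 1 0) in Hq dE.
set r1 := dot dw (frame A 0 0 1) in Hr dE.
have sq : p * p + q * q + r * r = 1 by rewrite -(dot_frame _ _ _ _ _ _ rA) -wE.
have tq : p * p1 + q * q1 + r * r1 = 0.
  by rewrite -(dot_frame _ _ _ _ _ _ rA) -wE -dE.
rewrite dE /grad_re /grad_im !dot_frame // /chart_re /chart_im -/p -/q -/r; split.
- der; rewrite -/p -/r.
  transitivity (p1 / (1 - r) + (p * r1) / (1 - r) ^+ 2); first by field.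
  apply/esym.
  transitivity ((1 - 2 * p ^+ 2 / (1 - r) ^+ 2 +
      (p * p + q * q + r * r - r * r) / (1 - r) ^+ 2) / 2 * p1 -
      p * (p * p1 + q * q1 + r * r1) / (1 - r) ^+ 2 +
      p ^+ 2 * p1 / (1 - r) ^+ 2 + p * r * r1 / (1 - r) ^+ 2 +
      p / (1 - r) * r1).
    by field.
  by rewrite sq tq; field.
- der; rewrite -/q -/r.
  transitivity (q1 / (1 - r) + (q * r1) / (1 - r) ^+ 2); first by field.
  apply/esym.
  transitivity ((1 - 2 * q ^+ 2 / (1 - r) ^+ 2 +
      (p * p + q * q + r * r - r * r) / (1 - r) ^+ 2) / 2 * q1 -
      q * (p * p1 + q * q1 + r * r1) / (1 - r) ^+ 2 +
      q ^+ 2 * q1 / (1 - r) ^+ 2 + q * r * r1 / (1 - r) ^+ 2 +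
      q / (1 - r) * r1).
    by field.
  by rewrite sq tq; field.
Qed.

Lemma sdiffE {W : normedModType R} (F : E -> W) th v dF :
  has_der (fun s : R => F (radial (s *: v + th))) 0 dF -> sdiff F th v = dF.
Proof.
move=> H; rewrite /sdiff -(der_val H) derive1E /derive.
rewrite (_ : (fun h : R => h^-1 *: (((F \o radial) \o shift th) (h *: v) -
    (F \o radial) th)) = (fun h : R => h^-1 *:
  (((fun s : R => F (radial (s *: v + th))) \o shift 0) (h *: 1) -
   F (radial (0 *: v + th))))) //.
by apply: funext => h /=; rewrite !scale0r !add0r addr0 [h *: 1]mulr1.
Qed.

Lemma der_radial th v : dot th th = 1 ->
  has_der (fun s : R => radial (s *: v + th)) 0 (v - dot th v *: th).
Proof.
move=> th1.
have n1 : dot (0 *: v + th) (0 *: v + th) = 1 by rewrite scale0r add0r.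
have n0 : 0 < dot (0 *: v + th) (0 *: v + th) by rewrite n1.
have n2 : Num.sqrt (dot (0 *: v + th) (0 *: v + th)) != 0.
  by rewrite n1 sqrtr1 oner_eq0.
rewrite /radial; der; rewrite n1 sqrtr1 !scale0r !add0r ?addr0 !dotE (dotC v th).
by apply/rowP => i; rewrite !mxE; field.
Qed.

Lemma sphere_radial u : dot u u != 0 -> dot (radial u) (radial u) = 1.
Proof.
move=> u0; have up : 0 < dot u u by rewrite lt0r u0 dot_ge0.
rewrite /radial !dotE mulrA -invfM -expr2 sqr_sqrtr ?ltW // mulVf //.
Qed.

(** A derivative on the sphere is computed in a chart by lifting the curve
    [s |-> radial (th + s v)] to the coordinates of the chart. *)
Lemma sdiff_chart {W : normedModType R} (F : E -> W) x y v dF :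
  (forall a b : R -> R, a 0 = x -> b 0 = y ->
     has_der a 0 (dot (grad_re A x y) v) -> has_der b 0 (dot (grad_im A x y) v) ->
     has_der (fun s : R => F (chart A (a s) (b s))) 0 dF) ->
  sdiff F (chart A x y) v = dF.
Proof.
move=> H; set th := chart A x y.
have th1 : dot th th = 1 by exact: chart_sphere.
pose w (s : R) := radial (s *: v + th).
have w0 : w 0 = th.
  by rewrite /w scale0r add0r /radial th1 sqrtr1 invr1 scale1r.
have Hw := der_radial v th1; rewrite -/w in Hw.
have wd : dot (w 0) (v - dot th v *: th) = 0.
  by rewrite w0 !dotE th1 mulr1 subrr.
have wn : 1 - dot (w 0) (frame A 0 0 1) != 0 by rewrite w0 chart_not_pole.
have ww : dot (w 0) (w 0) = 1 by rewrite w0.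
have [Ha Hb] := der_chart_coords Hw ww wn wd.
rewrite w0 chart_reK chart_imK in Ha Hb.
apply: sdiffE.
have tt u : dot u th = 0 -> dot u (v - dot th v *: th) = dot u v.
  by move=> ut; rewrite !dotE ut mulr0 subr0.
rewrite !tt in Ha Hb; last 2 first.
  by rewrite dotC dot_chart_grad_im.
  by rewrite dotC dot_chart_grad_re.
apply: der_near (H _ _ _ _ Ha Hb); last 2 first.
- by rewrite w0 chart_reK.
- by rewrite w0 chart_imK.
have n0 : dot (0 *: v + th) (0 *: v + th) != 0.
  by rewrite scale0r add0r th1 oner_eq0.
have [d1 D1] : exists d, has_der (fun s => dot (s *: v + th) (s *: v + th)) 0 d.
  by eexists; repeat der_step.
have [d2 D2] : exists d, has_der (fun s => 1 - dot (w s) (frame A 0 0 1)) 0 d.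
  by eexists; repeat der_step.
near=> s; rewrite chartK //.
- by apply: sphere_radial; near: s; exact: der_near_neq0 D1 n0.
- by near: s; exact: der_near_neq0 D2 wn.
Unshelve. all: by end_near. Qed.

End Rot.
End Chart.

(** * The function rho in a conformal chart *)

Section ConformalChart.
Context {R : realType}.
Local Notation E := 'rV[R]_3.
Local Notation C := (R[i])^o.
Local Notation Re := (@complex.Re R).
Local Notation Im := (@complex.Im R).
Variables (Omega : set E) (f : E -> C) (rhoO : E -> R) (t : R) (A : 'M[R]_3).
Hypotheses (dom : sphere_domain Omega) (conf : conformal_bijection Omega f)
  (hrho : is_rho_Omega Omega f rhoO) (rA : rotation A).
Local Notation rho := (fun th => rhoO th + t).
Local Notation h := (f \o stereo A).
Local Notation z x y := ((x +i* y)%C : C).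
Local Notation O x y := (Omega (chart A x y)).

Lemma ln_sqrt (x : R) : 0 < x -> ln (Num.sqrt x) = 2^-1 * ln x.
Proof.
move=> x0; have s0 : 0 < Num.sqrt x by rewrite sqrtr_gt0.
by rewrite -[in RHS](sqr_sqrtr (ltW x0)) lnXn // mulr2n; field.
Qed.

Definition val_re x y := Re (h (z x y)).
Definition val_im x y := Im (h (z x y)).
Definition der_re x y := Re (derive1 h (z x y)).
Definition der_im x y := Im (derive1 h (z x y)).
Definition pre_schwarzian : C -> C := fun w => derive1n 2 h w / derive1 h w.
Definition pre_re x y := Re (pre_schwarzian (z x y)).
Definition pre_im x y := Im (pre_schwarzian (z x y)).
Definition schw_re x y := Re (schwarzian h (z x y)).
Definition schw_im x y := Im (schwarzian h (z x y)).
Definition norm_der x y := der_re x y ^+ 2 + der_im x y ^+ 2.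
Definition disk_gap x y := 1 - (val_re x y ^+ 2 + val_im x y ^+ 2).

Lemma derivable_h n x y : O x y -> derivable (derive1n n h) (z x y) 1.
Proof. by move=> /(conf.2 A _ rA) []. Qed.

Lemma derive1_h_neq0 x y : O x y -> derive1 h (z x y) != 0.
Proof. by move=> /(conf.2 A _ rA) []. Qed.

Lemma norm_der_gt0 x y : O x y -> 0 < norm_der x y.
Proof. by move=> /derive1_h_neq0 /complex_neq0. Qed.

Lemma disk_gap_gt0 x y : O x y -> 0 < disk_gap x y.
Proof.
case: conf => -[/(_ (chart A x y)) H _ _] _ /H.
rewrite /unit_disk /= /disk_gap /val_re /val_im /chart /=; case: (f _) => a b /=.
rewrite -[X in _ < X -> _](sqrtr1 R) ltr_sqrt // => ?.
by rewrite subr_gt0.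
Qed.

Lemma near_domain (a b : R -> R) s da db : has_der a s da -> has_der b s db ->
  O (a s) (b s) -> \forall u \near s, O (a u) (b u).
Proof.
move=> Ha Hb Os; have Hp := der_chart A Ha Hb.
case: dom => _ [U oU UE] _.
rewrite UE in Os *.
have nU : nbhs (chart A (a s) (b s)) U by apply: open_nbhs_nbhs; split=> //; case: Os.
have : \forall u \near s, U (chart A (a u) (b u)) := der_cont Hp nU.
apply: filterS => u /= Uu; split => //; exact: (chart_sphere rA).
Qed.

Lemma pre_schwarzian_derivable x y : O x y -> derivable pre_schwarzian (z x y) 1.
Proof.
move=> Oxy; apply: (derivable_div (derive1_h_neq0 Oxy) _ _).1.
  exact: (derivable_h (n:=2%N) Oxy).
exact: (derivable_h (n:=1%N) Oxy).
Qed.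

Lemma derive1_pre_schwarzian x y :
  Re (derive1 pre_schwarzian (z x y)) =
  schw_re x y + (pre_re x y ^+ 2 - pre_im x y ^+ 2) / 2 /\
  Im (derive1 pre_schwarzian (z x y)) =
  schw_im x y + pre_re x y * pre_im x y.
Proof.
have E : derive1 pre_schwarzian (z x y) = schwarzian h (z x y) +
    2^-1 * (pre_schwarzian (z x y) ^+ 2).
  by rewrite /schwarzian subrK.
rewrite E /schw_re /schw_im /pre_re /pre_im.
have H2 : (2^-1 : C) = (2^-1 +i* 0)%C.
  by apply/eqP; rewrite eq_complex Re_half Im_half !eqxx.
rewrite H2; case: (schwarzian _ _) => c d; case: (pre_schwarzian _) => p q.
by split=> /=; field.
Qed.

Lemma derive2_h_parts x y : O x y ->
  Re (derive1n 2 h (z x y)) = pre_re x y * der_re x y - pre_im x y * der_im x y /\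
  Im (derive1n 2 h (z x y)) = pre_re x y * der_im x y + pre_im x y * der_re x y.
Proof.
move=> Oxy.
have -> : derive1n 2 h (z x y) = pre_schwarzian (z x y) * derive1 h (z x y).
  by rewrite /pre_schwarzian divfK ?derive1_h_neq0.
by rewrite -ReM -ImM.
Qed.

Section Curve.
Variables (a b : R -> R) (s da db : R).
Hypotheses (Ha : has_der a s da) (Hb : has_der b s db) (Os : O (a s) (b s)).

Lemma der_val_parts :
  has_der (fun u => val_re (a u) (b u)) s
    (der_re (a s) (b s) * da - der_im (a s) (b s) * db) /\
  has_der (fun u => val_im (a u) (b u)) s
    (der_re (a s) (b s) * db + der_im (a s) (b s) * da).
Proof.
have [H1 H2] := der_comp_complex (derivable_h (n:=0%N) Os) Ha Hb erefl.
by rewrite ReM in H1; rewrite ImM in H2.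
Qed.

Lemma der_der_parts :
  let p := pre_re (a s) (b s) in let q := pre_im (a s) (b s) in
  let u := der_re (a s) (b s) in let v := der_im (a s) (b s) in
  has_der (fun u => der_re (a u) (b u)) s
    ((p * u - q * v) * da - (p * v + q * u) * db) /\
  has_der (fun u => der_im (a u) (b u)) s
    ((p * u - q * v) * db + (p * v + q * u) * da).
Proof.
have [H1 H2] := der_comp_complex (derivable_h (n:=1%N) Os) Ha Hb erefl.
rewrite ReM in H1; rewrite ImM in H2.
have [E1 E2] := derive2_h_parts Os.
by rewrite /= -E1 -E2.
Qed.

Lemma der_pre_parts :
  let p := pre_re (a s) (b s) in let q := pre_im (a s) (b s) in
  let u := schw_re (a s) (b s) in let v := schw_im (a s) (b s) in
  has_der (fun u => pre_re (a u) (b u)) s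
    ((u + (p ^+ 2 - q ^+ 2) / 2) * da - (v + p * q) * db) /\
  has_der (fun u => pre_im (a u) (b u)) s
    ((u + (p ^+ 2 - q ^+ 2) / 2) * db + (v + p * q) * da).
Proof.
have [H1 H2] := der_comp_complex (pre_schwarzian_derivable Os) Ha Hb erefl.
rewrite ReM in H1; rewrite ImM in H2.
have [E1 E2] := derive1_pre_schwarzian (a s) (b s).
by rewrite /= -E1 -E2.
Qed.

(** On the domain the Schwarzian is a rational function of [h'], [h''], [h'''];
    in that form it is seen to be differentiable. *)
Lemma der_schw_parts : (exists dS, has_der (fun u => schw_re (a u) (b u)) s dS) /\
  (exists dS, has_der (fun u => schw_im (a u) (b u)) s dS).
Proof.
pose Q : C -> C := fun w => (derive1n 3 h w * derive1 h w -
  derive1n 2 h w * derive1n 2 h w) / derive1 h w ^+ 2.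
have Oz n := derivable_h (n:=n) Os.
have dQ : derivable Q (z (a s) (b s)) 1.
  apply: (derivable_div _ _ _).1.
  - by rewrite expf_neq0 ?derive1_h_neq0.
  - by apply: derivable_wronskian; [exact: (Oz 3%N)|exact: (Oz 1%N)|exact: (Oz 2%N)].
  - by apply: derivable_sqr; exact: (Oz 1%N).
have QE x y : O x y -> derive1 pre_schwarzian (z x y) = Q (z x y).
  move=> Oxy; apply: (derivable_div (derive1_h_neq0 Oxy) _ _).2.
    exact: (derivable_h (n:=2%N) Oxy).
  exact: (derivable_h (n:=1%N) Oxy).
have [H1 H2] := der_comp_complex dQ Ha Hb erefl.
have [HP1 HP2] := der_pre_parts.
have nO := near_domain Ha Hb Os.
split.
- have [d D] : exists d, has_der (fun u => Re (Q (z (a u) (b u))) -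
      (pre_re (a u) (b u) ^+ 2 - pre_im (a u) (b u) ^+ 2) / 2) s d.
    by eexists; repeat der_step.
  exists d; apply: der_near D; apply: filterS nO => u Ou.
  by rewrite -QE // (derive1_pre_schwarzian _ _).1 addrK.
- have [d D] : exists d, has_der (fun u => Im (Q (z (a u) (b u))) -
      pre_re (a u) (b u) * pre_im (a u) (b u)) s d.
    by eexists; repeat der_step.
  exists d; apply: der_near D; apply: filterS nO => u Ou.
  by rewrite -QE // (derive1_pre_schwarzian _ _).2 addrK.
Qed.

End Curve.

Lemma rho_chart x y : O x y ->
  rho (chart A x y) =
  2^-1 * ln (norm_der x y) + ln (1 + x ^+ 2 + y ^+ 2) - ln (disk_gap x y) + t.
Proof.
move=> Oxy; have D0 := den_gt0 x y.
have m1p := norm_der_gt0 Oxy; have m0p := disk_gap_gt0 Oxy.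
congr (_ + _); rewrite /chart (hrho rA Oxy).
have -> : ComplexField.Normc.normc (derive1 h (z x y)) = Num.sqrt (norm_der x y).
  by rewrite /norm_der /der_re /der_im; case: (derive1 _ _).
have -> : 1 - ComplexField.Normc.normc (f (stereo A (z x y))) ^+ 2 = disk_gap x y.
  rewrite /disk_gap /val_re /val_im /=; case: (f _) => a b /=.
  by rewrite sqr_sqrtr // addr_ge0 ?sqr_ge0.
rewrite /stereo_factor /= invf_div.
have -> : 2 * Num.sqrt (norm_der x y) * ((1 + x ^+ 2 + y ^+ 2) / 2) =
  Num.sqrt (norm_der x y) * (1 + x ^+ 2 + y ^+ 2) by field.
have s0 : 0 < Num.sqrt (norm_der x y) by rewrite sqrtr_gt0.
rewrite lnM ?posrE ?mulr_gt0 ?invr_gt0 // lnM ?posrE // lnV ?posrE //.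
by rewrite ln_sqrt.
Qed.

(** The partial derivatives of rho in the chart: [rho_x - i rho_y] is
    [h''/h' + 2 h' conj h / (1 - |h|^2) + 2 conj z / (1 + |z|^2)]. *)
Definition rho_x x y :=
  pre_re x y
  + 2 * (der_re x y * val_re x y + der_im x y * val_im x y) / disk_gap x y
  + 2 * x / (1 + x ^+ 2 + y ^+ 2).
Definition rho_y x y :=
  - pre_im x y
  + 2 * (der_re x y * val_im x y - der_im x y * val_re x y) / disk_gap x y
  + 2 * y / (1 + x ^+ 2 + y ^+ 2).
(** Half of the Laplacian of rho for the flat metric of the chart. *)
Definition half_laplacian x y :=
  2 * norm_der x y / disk_gap x y ^+ 2 + 2 / (1 + x ^+ 2 + y ^+ 2) ^+ 2.

Section Curve.
Variables (a b : R -> R) (s da db : R).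
Hypotheses (Ha : has_der a s da) (Hb : has_der b s db) (Os : O (a s) (b s)).
Let x := a s.
Let y := b s.

Lemma der_rho : has_der (fun u => rho (chart A (a u) (b u))) s
  (rho_x x y * da + rho_y x y * db).
Proof.
have D0 := den_gt0 (a s) (b s); have Dn := den_neq0 (a s) (b s).
have m1p := norm_der_gt0 Os; have m0p := disk_gap_gt0 Os.
have m1n : norm_der (a s) (b s) != 0 by rewrite gt_eqF.
have m0n : disk_gap (a s) (b s) != 0 by rewrite gt_eqF.
have [Hr Hi] := der_val_parts Ha Hb Os.
have [H1r H1i] := der_der_parts Ha Hb Os.
have H : has_der (fun u => 2^-1 * ln (norm_der (a u) (b u)) +
   ln (1 + a u ^+ 2 + b u ^+ 2) - ln (disk_gap (a u) (b u)) + t) s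
   (rho_x x y * da + rho_y x y * db).
  rewrite /norm_der /disk_gap in m1p m0p *; der.
  rewrite /rho_x /rho_y.
  rewrite /x /y; rewrite /norm_der in m1n; rewrite /disk_gap in m0n *.
  by field; rewrite m1n m0n Dn.
apply: der_near H.
by apply: filterS (near_domain Ha Hb Os) => u Ou; rewrite rho_chart.
Qed.

(** Writing [G = rho_x - i rho_y] and [B = 2 conj z / (1 + |z|^2)], both this
    lemma and the next one say that
    [G' = S zeta + G^2 zeta / 2 - G B zeta + k conj zeta]
    along a curve with velocity [zeta], where [S] is the Schwarzian and [k] is
    [half_laplacian]: the terms of [h] that are not the Schwarzian complete the
    square [G^2]. *)
Lemma der_rho_x : has_der (fun u => rho_x (a u) (b u)) s
  (schw_re x y * da - schw_im x y * db
   + ((rho_x x y ^+ 2 - rho_y x y ^+ 2) * da + 2 * rho_x x y * rho_y x y * db) / 2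
   - 2 / (1 + x ^+ 2 + y ^+ 2) *
     ((rho_x x y * x - rho_y x y * y) * da + (rho_x x y * y + rho_y x y * x) * db)
   + half_laplacian x y * da).
Proof.
have Dn := den_neq0 (a s) (b s).
have m0p := disk_gap_gt0 Os.
have m0n : disk_gap (a s) (b s) != 0 by rewrite gt_eqF.
have [Hr Hi] := der_val_parts Ha Hb Os.
have [H1r H1i] := der_der_parts Ha Hb Os.
have [HPr HPi] := der_pre_parts Ha Hb Os.
rewrite /rho_x /disk_gap in m0n *; der.
rewrite /half_laplacian /rho_y /norm_der /disk_gap /x /y.
by field; rewrite m0n Dn.
Qed.

Lemma der_rho_y : has_der (fun u => rho_y (a u) (b u)) s
  (- (schw_re x y * db + schw_im x y * da)
   - ((rho_x x y ^+ 2 - rho_y x y ^+ 2) * db - 2 * rho_x x y * rho_y x y * da) / 2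
   + 2 / (1 + x ^+ 2 + y ^+ 2) *
     ((rho_x x y * x - rho_y x y * y) * db - (rho_x x y * y + rho_y x y * x) * da)
   + half_laplacian x y * db).
Proof.
have Dn := den_neq0 (a s) (b s).
have m0p := disk_gap_gt0 Os.
have m0n : disk_gap (a s) (b s) != 0 by rewrite gt_eqF.
have [Hr Hi] := der_val_parts Ha Hb Os.
have [H1r H1i] := der_der_parts Ha Hb Os.
have [HPr HPi] := der_pre_parts Ha Hb Os.
rewrite /rho_y /disk_gap in m0n *; der.
rewrite /half_laplacian /rho_x /norm_der /disk_gap /x /y.
by field; rewrite m0n Dn.
Qed.

End Curve.

Lemma sgrad_chart x y : O x y ->
  sgrad rho (chart A x y) = rho_x x y *: grad_re A x y + rho_y x y *: grad_im A x y.
Proof.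
move=> Oxy; apply/rowP => i; rewrite [LHS]mxE [RHS]mxE.
rewrite [X in _ = X + _]mxE [X in _ = _ + X]mxE.
apply: (sdiff_chart rA) => a b a0 b0 Ha Hb.
rewrite !dot_delta in Ha Hb.
have Os : O (a 0) (b 0) by rewrite a0 b0.
by have := der_rho Ha Hb Os; rewrite a0 b0.
Qed.

(** * The envelope in a conformal chart *)

Definition exp_rho x y := expR (rho (chart A x y)).
Definition grad_rho x y : E :=
  rho_x x y *: grad_re A x y + rho_y x y *: grad_im A x y.
Definition axis x y : E := grad_rho x y - (exp_rho x y + 1) *: chart A x y.
Definition axis_sq x y := dot (axis x y) (axis x y).
(** Half of the trace of the shape operator. *)
Definition shape_mean x y :=
  (half_laplacian x y - (rho_x x y ^+ 2 + rho_y x y ^+ 2) / 2) / metric x y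
  + axis_sq x y / 2 - exp_rho x y - 1.
(** The vector with chart component [shape_mean * zeta + conj (S zeta) / metric], for
    [zeta = al + i be]: the trace-free part of the shape operator is the
    Schwarzian. *)
Definition shape_chart x y al be : E :=
  (shape_mean x y * metric x y * al + (schw_re x y * al - schw_im x y * be)) *: grad_re A x y +
  (shape_mean x y * metric x y * be - (schw_re x y * be + schw_im x y * al)) *: grad_im A x y.
Definition tang x y al be : E :=
  metric x y *: (al *: grad_re A x y + be *: grad_im A x y).

Lemma exp_rho_gt0 x y : 0 < exp_rho x y.
Proof. exact: expR_gt0. Qed.

Lemma dot_grad_rho_chart x y : dot (grad_rho x y) (chart A x y) = 0.
Proof.
rewrite /grad_rho !dotE (dotC _ (chart A x y)) (dotC _ (chart A x y)).
by rewrite (dot_chart_grad_re rA) (dot_chart_grad_im rA); ring.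
Qed.

Lemma dot_axis_chart x y : dot (axis x y) (chart A x y) = - (exp_rho x y + 1).
Proof.
by rewrite /axis dotDl dotNl dotZl dot_grad_rho_chart (chart_sphere rA); ring.
Qed.

Lemma axis_sq_neq0 x y : axis_sq x y != 0.
Proof. exact: (axis_neq0 (dot_axis_chart x y) (exp_rho_gt0 x y)). Qed.

Lemma axis_sqE x y :
  axis_sq x y = dot (grad_rho x y) (grad_rho x y) + (exp_rho x y + 1) ^+ 2.
Proof.
rewrite /axis_sq /axis; have := dot_grad_rho_chart x y; move: (grad_rho x y) => D Dp.
by rewrite !dotE (dotC (chart A x y) D) Dp (chart_sphere rA); ring.
Qed.

Lemma R_map_chart x y : O x y ->
  R_map rho (chart A x y) = envelope (chart A x y) (axis x y).
Proof.
move=> Oxy; rewrite /R_map (sgrad_chart Oxy) -/(grad_rho x y).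
have -> : expR (2 * (rhoO (chart A x y) + t)) = exp_rho x y ^+ 2.
  by rewrite /exp_rho expRM_natl.
rewrite -/(exp_rho x y) /envelope -/(axis_sq x y) -axis_sqE.
have := axis_sqE x y; have := axis_sq_neq0 x y; rewrite /axis.
move: (axis_sq x y) (exp_rho x y) => d e.
move=> d0 dE; have -> : dot (grad_rho x y) (grad_rho x y) = d - (e + 1) ^+ 2 by rewrite dE; ring.
by apply/rowP => i; rewrite !mxE; field.
Qed.

Lemma dot_chart_tang x y al be : dot (chart A x y) (tang x y al be) = 0.
Proof. by rewrite /tang !dotE (dot_chart_grad_re rA) (dot_chart_grad_im rA); ring. Qed.

Lemma dot_chart_shape x y al be : dot (chart A x y) (shape_chart x y al be) = 0.
Proof.
by rewrite /shape_chart !dotE (dot_chart_grad_re rA) (dot_chart_grad_im rA); ring.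
Qed.

Lemma dot_grad_re_tang x y al be : dot (grad_re A x y) (tang x y al be) = al.
Proof.
rewrite /tang !dotE (grad_re_sq rA) (dot_grad_re_im rA).
by have := metric_gt0 x y => g0; field; rewrite gt_eqF.
Qed.

Lemma dot_grad_im_tang x y al be : dot (grad_im A x y) (tang x y al be) = be.
Proof.
rewrite /tang !dotE (grad_im_sq rA) (dotC _ (grad_re A x y)) (dot_grad_re_im rA).
by have := metric_gt0 x y => g0; field; rewrite gt_eqF.
Qed.

Lemma tangE x y v : dot (chart A x y) v = 0 ->
  v = tang x y (dot (grad_re A x y) v) (dot (grad_im A x y) v).
Proof. by move=> pv; rewrite [LHS](chart_decomp rA x y) pv scale0r addr0. Qed.

Lemma dot_shape_tang x y al be al' be' :
  dot (shape_chart x y al be) (tang x y al' be') =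
  (shape_mean x y * metric x y * al + (schw_re x y * al - schw_im x y * be)) * al' +
  (shape_mean x y * metric x y * be - (schw_re x y * be + schw_im x y * al)) * be'.
Proof. by rewrite /shape_chart dotDl !dotZl dot_grad_re_tang dot_grad_im_tang. Qed.

Lemma dot_tang_tang x y al be al' be' :
  dot (tang x y al be) (tang x y al' be') = metric x y * (al * al' + be * be').
Proof. by rewrite {1}/tang dotZl dotDl !dotZl dot_grad_re_tang dot_grad_im_tang. Qed.

Lemma dot_axis_tang x y al be :
  dot (axis x y) (tang x y al be) = rho_x x y * al + rho_y x y * be.
Proof.
rewrite /axis dotDl dotNl dotZl dot_chart_tang /grad_rho dotDl !dotZl.
by rewrite dot_grad_re_tang dot_grad_im_tang; ring.
Qed.

(** The heart of the matter: in the derivative of [axis] the term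
    [G^2 zeta / 2] is cancelled, up to a multiple of the identity, by
    [D rho (x) D rho], and [G B zeta] is cancelled by the derivatives of the
    coordinate fields, so that only the Schwarzian is left beside the identity.
    The derivatives of [rho_x] and [rho_y] and of the coordinate fields are
    written out here. *)
Lemma shape_chart_identity x y al be :
  let r := rho_x x y * al + rho_y x y * be in
  let dcp := schw_re x y * al - schw_im x y * be
   + ((rho_x x y ^+ 2 - rho_y x y ^+ 2) * al + 2 * rho_x x y * rho_y x y * be) / 2
   - 2 / (1 + x ^+ 2 + y ^+ 2) *
     ((rho_x x y * x - rho_y x y * y) * al + (rho_x x y * y + rho_y x y * x) * be)
   + half_laplacian x y * al in
  let dcq := - (schw_re x y * be + schw_im x y * al)
   - ((rho_x x y ^+ 2 - rho_y x y ^+ 2) * be - 2 * rho_x x y * rho_y x y * al) / 2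
   + 2 / (1 + x ^+ 2 + y ^+ 2) *
     ((rho_x x y * x - rho_y x y * y) * be - (rho_x x y * y + rho_y x y * x) * al)
   + half_laplacian x y * be in
  let W := dcp *: grad_re A x y
    + rho_x x y *: frame A (- (x * al) + y * be) (- (al * y + x * be)) al
    + (dcq *: grad_im A x y + rho_y x y *: frame A (- (al * y + x * be)) (x * al - y * be) be) in
  (axis_sq x y / 2) *: tang x y al be - r *: axis x y +
   (W - (exp_rho x y * r *: chart A x y + (exp_rho x y + 1) *: tang x y al be)) =
  shape_chart x y al be.
Proof.
move=> r dcp dcq W; rewrite /axis /shape_chart /shape_mean /grad_rho.
move: (axis_sq x y) (exp_rho x y) => d e.
rewrite /W /tang chartE /grad_re /grad_im !(frameZ, frameN, frameD) /r /dcp /dcq /metric.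
move: (rho_x x y) (rho_y x y) (schw_re x y) (schw_im x y) (half_laplacian x y) => p q u v k.
have Dn := den_neq0 x y.
by congr frame; field.
Qed.

Lemma der_grad_re (a b : R -> R) s da db : has_der a s da -> has_der b s db ->
  has_der (fun u => grad_re A (a u) (b u)) s
    (frame A (- (a s * da) + b s * db) (- (da * b s + a s * db)) da).
Proof.
move=> Ha Hb; rewrite /grad_re; eapply derEq; first by apply: der_frame; repeat der_step.
by cbv beta; congr frame; field.
Qed.

Lemma der_grad_im (a b : R -> R) s da db : has_der a s da -> has_der b s db ->
  has_der (fun u => grad_im A (a u) (b u)) s
    (frame A (- (da * b s + a s * db)) (a s * da - b s * db) db).
Proof.
move=> Ha Hb; rewrite /grad_im; eapply derEq; first by apply: der_frame; repeat der_step.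
by cbv beta; congr frame; field.
Qed.

Section Curve.
Variables (a b : R -> R) (s da db : R).
Hypotheses (Ha : has_der a s da) (Hb : has_der b s db) (Os : O (a s) (b s)).
Let x := a s.
Let y := b s.

Lemma der_exp_rho : has_der (fun u => exp_rho (a u) (b u)) s
  (exp_rho x y * (rho_x x y * da + rho_y x y * db)).
Proof.
have Hr := der_rho Ha Hb Os.
by rewrite /exp_rho; eapply derEq; [apply: der_exp Hr|rewrite mulrC].
Qed.

Lemma der_axis : exists2 dP, has_der (fun u => axis (a u) (b u)) s dP &
  (axis_sq x y / 2) *: tang x y da db - dot (axis x y) (tang x y da db) *: axis x y + dP =
  shape_chart x y da db.
Proof.
have He := der_exp_rho; have Hp := der_chart A Ha Hb.
have H1 := der_grad_re Ha Hb; have H2 := der_grad_im Ha Hb.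
have Hcp := der_rho_x Ha Hb Os; have Hcq := der_rho_y Ha Hb Os.
eexists; first by rewrite /axis /grad_rho; repeat der_step.
cbv beta; rewrite dot_axis_tang -(shape_chart_identity x y da db) /= -/x -/y.
congr (_ + _); congr (_ + _); congr (- _); congr (_ + _).
by rewrite addr0.
Qed.

Lemma der_R_map : has_der (fun u => R_map rho (chart A (a u) (b u))) s
  ((2 / axis_sq x y) *: refl (axis x y) (shape_chart x y da db)).
Proof.
have [dP HP E1] := der_axis; have Hp := der_chart A Ha Hb.
have H : has_der (fun u => envelope (chart A (a u) (b u)) (axis (a u) (b u))) s
  ((2 / axis_sq x y) *: refl (axis x y) (shape_chart x y da db)).
  by rewrite -E1; apply: (der_envelope Hp HP); exact: axis_sq_neq0.
apply: der_near H.
by apply: filterS (near_domain Ha Hb Os) => u Ou; rewrite R_map_chart.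
Qed.

End Curve.

Lemma sdiff_R_map x y v : O x y ->
  sdiff (R_map rho) (chart A x y) v =
  (2 / axis_sq x y) *: refl (axis x y)
    (shape_chart x y (dot (grad_re A x y) v) (dot (grad_im A x y) v)).
Proof.
move=> Oxy; apply: (sdiff_chart rA) => a b a0 b0 Ha Hb.
have Os : O (a 0) (b 0) by rewrite a0 b0.
by have := der_R_map Ha Hb Os; rewrite a0 b0.
Qed.

(** * Principal directions and the quadratic differential *)

Definition scaled_mean x y := shape_mean x y * metric x y.
Definition shape_det x y :=
  scaled_mean x y ^+ 2 - (schw_re x y ^+ 2 + schw_im x y ^+ 2).

Lemma shape_chart_eq0P x y al be : shape_chart x y al be = 0 <->
  (scaled_mean x y + schw_re x y) * al - schw_im x y * be = 0 /\
  (scaled_mean x y - schw_re x y) * be - schw_im x y * al = 0.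
Proof.
split=> [M0|[H1 H2]].
  have := dot_shape_tang x y al be 1 0.
  have := dot_shape_tang x y al be 0 1.
  by rewrite M0 !dot0l /scaled_mean => H1 H2; split; [rewrite [RHS]H2|rewrite [RHS]H1]; ring.
rewrite /shape_chart -/(scaled_mean x y).
rewrite (_ : scaled_mean x y * al + _ = 0); last by rewrite -[RHS]H1; ring.
rewrite (_ : scaled_mean x y * be - _ = 0); last by rewrite -[RHS]H2; ring.
by rewrite !scale0r addr0.
Qed.

Lemma shape_chart_inj_of_det x y al be :
  shape_det x y != 0 -> shape_chart x y al be = 0 ->
  al = 0 /\ be = 0.
Proof.
move=> d0 /shape_chart_eq0P [H1 H2]; split; apply: (mulfI d0); rewrite mulr0 /shape_det.
- transitivity ((scaled_mean x y - schw_re x y) *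
      ((scaled_mean x y + schw_re x y) * al - schw_im x y * be) +
    schw_im x y * ((scaled_mean x y - schw_re x y) * be - schw_im x y * al)); first by ring.
  by rewrite H1 H2; ring.
- transitivity (schw_im x y * ((scaled_mean x y + schw_re x y) * al - schw_im x y * be) +
    (scaled_mean x y + schw_re x y) *
      ((scaled_mean x y - schw_re x y) * be - schw_im x y * al)); first by ring.
  by rewrite H1 H2; ring.
Qed.

Section Point.
Variables (x y : R).
Hypothesis Oxy : O x y.

Lemma sdiff_R_map_tang al be : sdiff (R_map rho) (chart A x y) (tang x y al be) =
  (2 / axis_sq x y) *: refl (axis x y) (shape_chart x y al be).
Proof.
rewrite (sdiff_R_map _ Oxy).
by rewrite (dot_grad_re_tang) (dot_grad_im_tang).
Qed.

Lemma immersed_shape_inj al be : immersed_at rho (chart A x y) ->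
  shape_chart x y al be = 0 -> al = 0 /\ be = 0.
Proof.
move=> im M0; have v0 : tang x y al be = 0.
  apply: im; first exact: (dot_chart_tang).
  by rewrite sdiff_R_map_tang M0 /refl dotC dot0l mulr0 mul0r scale0r subr0 scaler0.
have := dot_grad_re_tang x y al be; have := dot_grad_im_tang x y al be.
by rewrite v0 !(dotC _ 0) !dot0l.
Qed.

(** When the determinant of the symmetric two by two matrix vanishes, the first
    two vectors below are in its kernel; if both are zero, so is the matrix. *)
Lemma immersed_det : immersed_at rho (chart A x y) -> shape_det x y != 0.
Proof.
move=> im; apply/eqP; rewrite /shape_det => d0.
have [|E1 E2] := immersed_shape_inj (al := schw_im x y) (be := scaled_mean x y + schw_re x y) im.
  by apply/shape_chart_eq0P; split; [|rewrite -[RHS]d0]; ring.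
have [|E3 _] := immersed_shape_inj (al := scaled_mean x y - schw_re x y) (be := schw_im x y) im.
  by apply/shape_chart_eq0P; split; [rewrite -[RHS]d0|]; ring.
have [|/eqP] := immersed_shape_inj (al := 1) (be := 0) im; last by rewrite oner_eq0.
by apply/shape_chart_eq0P; rewrite E1 E2 E3; split; ring.
Qed.

Lemma det_immersed : shape_det x y != 0 -> immersed_at rho (chart A x y).
Proof.
move=> d0 v tv; rewrite [v](tangE tv) sdiff_R_map_tang => /eqP.
rewrite scaler_eq0 mulf_eq0 invr_eq0 pnatr_eq0 /= (negbTE (axis_sq_neq0 x y)) /=.
move=> /eqP /(refl_eq0 (axis_sq_neq0 x y)) /(shape_chart_inj_of_det d0) [-> ->].
by rewrite /tang !scale0r addr0 scaler0.
Qed.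

Lemma first_form_tang al be al' be' :
  first_form rho (chart A x y) (tang x y al be) (tang x y al' be') =
  dot (shape_chart x y al be) (shape_chart x y al' be') / exp_rho x y ^+ 2.
Proof.
have d0 := axis_sq_neq0 x y.
have e0 : exp_rho x y != 0 by rewrite gt_eqF // exp_rho_gt0.
rewrite /first_form !sdiff_R_map_tang /hyp_dot.
rewrite (R_map_chart Oxy).
rewrite (hyp_factor_envelope (chart_sphere rA x y) (dot_axis_chart x y) (exp_rho_gt0 _ _)).
rewrite !(dotZl, dotZr) dot_refl // -/(axis_sq x y).
by field; rewrite d0 e0.
Qed.

End Point.

Section Curve.
Variables (a b : R -> R) (s da db : R).
Hypotheses (Ha : has_der a s da) (Hb : has_der b s db) (Os : O (a s) (b s)).

Lemma der_shape_det : exists d, has_der (fun u => shape_det (a u) (b u)) s d.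
Proof.
have [[d1 D1] [d2 D2]] := der_schw_parts Ha Hb Os.
have [H1 H2] := der_val_parts Ha Hb Os.
have [H3 H4] := der_der_parts Ha Hb Os.
have m0n : disk_gap (a s) (b s) ^+ 2 != 0.
  by rewrite expf_neq0 // gt_eqF // (disk_gap_gt0 Os).
have Dn : (1 + a s ^+ 2 + b s ^+ 2) ^+ 2 != 0 by rewrite expf_neq0 // den_neq0.
have [d3 D3] : exists d, has_der (fun u => half_laplacian (a u) (b u)) s d.
  by rewrite /half_laplacian /norm_der /disk_gap in m0n *; eexists; repeat der_step.
have H5 := der_rho_x Ha Hb Os; have H6 := der_rho_y Ha Hb Os.
have H7 := der_exp_rho Ha Hb Os.
have [dP HP _] := der_axis Ha Hb Os.
have g2n : metric (a s) (b s) != 0 by rewrite gt_eqF // metric_gt0.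
have [d4 D4] : exists d, has_der (fun u => metric (a u) (b u)) s d.
  by rewrite /metric; eexists; repeat der_step.
by rewrite /shape_det /scaled_mean /shape_mean /axis_sq; eexists; repeat der_step.
Qed.

(** Immersion is an open condition along curves; this is what allows the normal,
    which is only prescribed at immersed points, to be differentiated. *)
Lemma near_immersed : immersed_at rho (chart A (a s) (b s)) ->
  \forall u \near s, O (a u) (b u) /\ immersed_at rho (chart A (a u) (b u)).
Proof.
move=> /(immersed_det Os) d0; have [d D] := der_shape_det.
apply: filterS2 (near_domain Ha Hb Os) (der_near_neq0 D d0) => u Ou du.
by split=> //; exact: det_immersed.
Qed.

End Curve.

Definition q_re x y al be :=
  schw_re x y * (al ^+ 2 - be ^+ 2) - schw_im x y * (2 * al * be).
Definition q_im x y al be :=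
  schw_re x y * (2 * al * be) + schw_im x y * (al ^+ 2 - be ^+ 2).

Lemma Re_q_Omega x y al be : Re (q_Omega f A (z x y) (z al be)) = q_re x y al be.
Proof.
rewrite /q_Omega /q_re /schw_re /schw_im; case: (schwarzian _ _) => p q /=.
by ring.
Qed.

Lemma Im_q_Omega x y al be : Im (q_Omega f A (z x y) (z al be)) = q_im x y al be.
Proof.
rewrite /q_Omega /q_im /schw_re /schw_im; case: (schwarzian _ _) => p q /=.
by ring.
Qed.

Lemma shape_op_chart x y v : O x y ->
  shape_op rhoO t (chart A x y) v =
  shape_chart x y (dot (grad_re A x y) v) (dot (grad_im A x y) v).
Proof.
move=> Oxy; rewrite /shape_op (sgrad_chart Oxy).
rewrite -/(exp_rho x y) -/(grad_rho x y) -/(axis x y) (sdiff_R_map _ Oxy).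
have d0 := axis_sq_neq0 x y.
rewrite refl_lin refl_invol // -/(axis_sq x y) scalerA.
by rewrite (_ : _ * _ = 1) ?scale1r //; field.
Qed.

(** The real part of the quadratic differential does not depend on the chart. *)
Lemma tracefree_chart x y al be : O x y ->
  tracefree rhoO t (chart A x y) (tang x y al be) = q_re x y al be.
Proof.
move=> Oxy; rewrite /tracefree shape_op_chart // (dot_grad_re_tang) (dot_grad_im_tang).
rewrite dot_shape_tang (dot_tang_tang).
have -> : \sum_(i < 3) shape_op rhoO t (chart A x y) (delta_mx ord0 i) ord0 i =
   (scaled_mean x y + schw_re x y) * dot (grad_re A x y) (grad_re A x y) +
   (scaled_mean x y - schw_re x y) * dot (grad_im A x y) (grad_im A x y) -
   2 * schw_im x y * dot (grad_re A x y) (grad_im A x y).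
  rewrite {1 2 3}/dot !mulr_sumr -big_split -sumrB; apply: eq_bigr => i _ /=.
  rewrite shape_op_chart // !dot_delta /shape_chart /scaled_mean.
  by move: (grad_re A x y) (grad_im A x y) => u v; rewrite !mxE; ring.
rewrite (grad_re_sq rA) (grad_im_sq rA) (dot_grad_re_im rA) /q_re /scaled_mean.
have g0 := metric_gt0 x y.
by field; rewrite gt_eqF.
Qed.

Section Normal.
Variable N : E -> E.
Hypothesis outN : outer_unit_normal Omega rho N.

(** Orthogonality to the image of the differential leaves the line spanned by
    the reflection of [theta], unit length leaves two vectors on it, and the
    horoball condition leaves one. *)
Lemma normal_chart x y : O x y -> immersed_at rho (chart A x y) ->
  N (chart A x y) = horo_normal (chart A x y) (exp_rho x y) (R_map rho (chart A x y)).
Proof.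
move=> Oxy im; have [n1 nT nH] := outN Oxy im.
have th1 := chart_sphere rA x y; have Pth := dot_axis_chart x y.
have e0 : 0 < exp_rho x y by exact: exp_rho_gt0.
have d0 := axis_sq_neq0 x y.
have en : exp_rho x y != 0 by rewrite gt_eqF.
rewrite (R_map_chart Oxy) in n1 nT nH *.
rewrite /hyp_dot (hyp_factor_envelope th1 Pth e0) -/(axis_sq x y) in n1 nT.
have l0 : (axis_sq x y / (2 * exp_rho x y)) ^+ 2 != 0.
  by rewrite expf_neq0 // mulf_neq0 // invr_eq0 mulf_neq0.
set n := N (chart A x y) in n1 nT nH *.
pose m := refl (axis x y) n.
pose p := dot (grad_re A x y) m; pose q := dot (grad_im A x y) m.
pose k := dot (chart A x y) m.
have mE : m = tang x y p q + k *: chart A x y.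
  exact: (chart_decomp rA x y m).
have mM al be : dot m (shape_chart x y al be) = 0.
  have := nT _ (dot_chart_tang x y al be).
  rewrite sdiff_R_map_tang // dotZr dot_refl_adj -/m => /eqP.
  rewrite mulf_eq0 (negbTE l0) /= mulf_eq0 mulf_eq0 invr_eq0 pnatr_eq0 /=.
  by rewrite (negbTE d0) => /eqP.
have pq al be : dot (shape_chart x y p q) (tang x y al be) = 0.
  rewrite -[RHS](mM al be) mE dotDl dotZl dot_chart_shape mulr0 addr0.
  rewrite (dotC (tang x y p q)) !dot_shape_tang.
  by ring.
have [p0 q0] : p = 0 /\ q = 0.
  apply: (immersed_shape_inj Oxy im); apply/shape_chart_eq0P.
  have := pq 1 0; have := pq 0 1; rewrite !dot_shape_tang -/(scaled_mean x y).
  by move=> H1 H2; split; [rewrite -[RHS]H2|rewrite -[RHS]H1]; ring.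
have nE : n = k *: refl (axis x y) (chart A x y).
  rewrite -[n](refl_invol _ d0) -/m mE p0 q0 -refl_lin.
  by rewrite /tang !scale0r addr0 scaler0 add0r.
have k2 : k ^+ 2 = (2 * exp_rho x y / axis_sq x y) ^+ 2.
  move: n1; rewrite nE dotZl dotZr dot_refl // th1 mulr1 => n1.
  apply: (mulfI l0); rewrite -[k ^+ 2]/(k * k) n1.
  by field; rewrite en d0.
have hE := horo_normalE th1 Pth e0; rewrite -/(axis_sq x y) in hE.
have /eqP := k2; rewrite eqf_sqr => /orP [] /eqP kE; last first.
  by rewrite nE kE hE.
exfalso.
have nE' : n = - horo_normal (chart A x y) (exp_rho x y) (envelope (chart A x y) (axis x y)).
  by rewrite nE kE hE; move: (refl _ _) => r; apply/rowP => i; rewrite !mxE; ring.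
have nn : 0 < dot n n.
  rewrite lt0r dot_ge0 andbT; apply/eqP => nn0.
  by move/eqP: n1; rewrite nn0 mulr0 eq_sym oner_eq0.
have [s [s0 Hs]] := filter_ex (filterI (nbhs_right_gt (0 : R)) nH).
apply: (anti_normal_not_inward th1 Pth e0 s0 nn nE').
case: Hs => _; rewrite /horoball /= expRN mulrC -/(exp_rho x y) => Hs.
by rewrite -ltr_pdivlMl // mulrC.
Qed.

Lemma second_form_tang x y al be al' be' :
  O x y -> immersed_at rho (chart A x y) ->
  second_form rho N (chart A x y) (tang x y al be) (tang x y al' be') =
  dot (shape_chart x y al be) (shape_chart x y al' be') / exp_rho x y ^+ 2 -
  dot (tang x y al be) (shape_chart x y al' be').
Proof.
move=> Oxy im.
have th1 := chart_sphere rA x y; have Pth := dot_axis_chart x y.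
have RE := R_map_chart Oxy.
have HN : sdiff N (chart A x y) (tang x y al be) =
    - dot (R_map rho (chart A x y)) (sdiff (R_map rho) (chart A x y) (tang x y al be)) *:
      (exp_rho x y *: (chart A x y - R_map rho (chart A x y)) - R_map rho (chart A x y)) +
     ((1 - dot (R_map rho (chart A x y)) (R_map rho (chart A x y))) / 2) *:
       ((exp_rho x y * (rho_x x y * al + rho_y x y * be)) *: (chart A x y - R_map rho (chart A x y))
        + exp_rho x y *: (tang x y al be - sdiff (R_map rho) (chart A x y) (tang x y al be))
        - sdiff (R_map rho) (chart A x y) (tang x y al be)).
  apply: (sdiff_chart rA) => a b a0 b0.
  rewrite (dot_grad_re_tang) (dot_grad_im_tang) => Ha Hb.
  have Os : O (a 0) (b 0) by rewrite a0 b0.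
  have Im : immersed_at rho (chart A (a 0) (b 0)) by rewrite a0 b0.
  have := der_horo_normal (der_chart A Ha Hb) (der_R_map Ha Hb Os)
    (der_exp_rho Ha Hb Os).
  rewrite (sdiff_R_map_tang Oxy) a0 b0.
  move=> D; refine (der_near _ D).
  by apply: filterS (near_immersed Ha Hb Os Im) => u [Ou Iu]; rewrite normal_chart.
rewrite /second_form HN normal_chart // !sdiff_R_map_tang // RE.
apply: (second_form_envelope th1 Pth (exp_rho_gt0 _ _)).
- exact: (dot_axis_tang).
- exact: (dot_chart_tang).
- exact: dot_chart_shape.
- exact: dot_chart_shape.
Qed.

(** Since [I = Mv.Mw / e^2] and [II = I - v.Mw] with [M] invertible and
    self-adjoint, [v] is principal exactly when [M v] is a multiple of [v]. In
    the chart [M v] is [shape_mean * zeta + conj (S zeta) / metric], and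
    [conj (S zeta)] is a real multiple of [zeta] exactly when [S zeta^2] is
    real. *)
Lemma principal_chart x y al be : O x y -> immersed_at rho (chart A x y) ->
  tang x y al be <> 0 ->
  principal_direction rho N (chart A x y) (tang x y al be) <-> q_im x y al be = 0.
Proof.
move=> Oxy im v0.
have e0 : exp_rho x y != 0 by rewrite gt_eqF // exp_rho_gt0.
have g0 : metric x y != 0 by rewrite gt_eqF // metric_gt0.
have ff al' be' := first_form_tang Oxy al be al' be'.
have sf al' be' := second_form_tang al be al' be' Oxy im.
pose c1 := scaled_mean x y * al + (schw_re x y * al - schw_im x y * be).
pose c2 := scaled_mean x y * be - (schw_re x y * be + schw_im x y * al).
have ME : shape_chart x y al be = tang x y (c1 / metric x y) (c2 / metric x y).
  rewrite /shape_chart /tang -/(scaled_mean x y) -/c1 -/c2 scalerDr !scalerA.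
  by congr (_ *: _ + _ *: _); field.
have sym p q p' q' : dot (tang x y p q) (shape_chart x y p' q') =
    dot (shape_chart x y p q) (tang x y p' q').
  by rewrite (dotC (tang x y p q)) !dot_shape_tang; ring.
have inj al' be' : (forall p q, dot (tang x y al' be') (shape_chart x y p q) = 0) ->
    al' = 0 /\ be' = 0.
  move=> H; apply: (immersed_shape_inj Oxy im).
  apply: dot_eq0; rewrite -[RHS](H (dot (grad_re A x y) (shape_chart x y al' be'))
    (dot (grad_im A x y) (shape_chart x y al' be'))) sym; congr dot.
  exact: (tangE (dot_chart_shape x y _ _)).
have n0 : 0 < al ^+ 2 + be ^+ 2.
  rewrite lt0r addr_ge0 ?sqr_ge0 // andbT paddr_eq0 ?sqr_ge0 // !sqrf_eq0.
  apply/negP => /andP [/eqP al0 /eqP be0]; apply: v0.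
  by rewrite al0 be0 /tang !scale0r addr0 scaler0.
split=> [[_ _ [k Hk]]|I0].
- (* II = k I reads v = ka * M v *)
  pose ka := (1 - k) / exp_rho x y ^+ 2.
  have [E1 E2] : ka * (c1 / metric x y) - al = 0 /\ ka * (c2 / metric x y) - be = 0.
    apply: inj => p q.
    have := Hk _ (dot_chart_tang x y p q); rewrite sf ff.
    have -> : tang x y (ka * (c1 / metric x y) - al) (ka * (c2 / metric x y) - be) =
        ka *: shape_chart x y al be - tang x y al be.
      rewrite ME /tang; move: (grad_re A x y) (grad_im A x y) => u v.
      by apply/rowP => i; rewrite !mxE; ring.
    move=> H; rewrite dotDl dotNl dotZl /ka.
    apply/eqP; rewrite subr_eq0; apply/eqP.
    rewrite -[RHS](subKr (dot (shape_chart x y al be) (shape_chart x y p q) / exp_rho x y ^+ 2)) H.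
    by field.
  have H : ka * q_im x y al be = 0.
    transitivity (metric x y * ((ka * (c1 / metric x y)) * be - (ka * (c2 / metric x y)) * al)).
      by rewrite /q_im /c1 /c2; field.
    move/eqP: E1; rewrite subr_eq0 => /eqP ->.
    by move/eqP: E2; rewrite subr_eq0 => /eqP ->; ring.
  move/eqP: H; rewrite mulf_eq0 => /orP [/eqP ka0|/eqP //].
  exfalso; apply: v0; move: E1 E2; rewrite ka0 !mul0r !sub0r => /eqP + /eqP.
  rewrite !oppr_eq0 => /eqP -> /eqP ->.
  by rewrite /tang !scale0r addr0 scaler0.
- pose mu := (c1 * al + c2 * be) / (al ^+ 2 + be ^+ 2).
  have nn : al ^+ 2 + be ^+ 2 != 0 by rewrite gt_eqF.
  have cc : c1 * be - c2 * al = 0 by rewrite -[RHS]I0 /q_im /c1 /c2; ring.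
  have E1 : c1 = mu * al.
    apply: (mulIf nn).
    transitivity (al * (c1 * al + c2 * be) + be * (c1 * be - c2 * al)); first by ring.
    by rewrite cc /mu; field.
  have E2 : c2 = mu * be.
    apply: (mulIf nn).
    transitivity (be * (c1 * al + c2 * be) - al * (c1 * be - c2 * al)); first by ring.
    by rewrite cc /mu; field.
  have ME2 : shape_chart x y al be = (mu / metric x y) *: tang x y al be.
    by rewrite ME E1 E2 /tang !scalerDr !scalerA; congr (_ *: _ + _ *: _); field.
  have mu0 : mu != 0.
    apply/eqP => mu0; apply: v0.
    have [|-> ->] := immersed_shape_inj (al := al) (be := be) Oxy im.
      by rewrite ME2 mu0 mul0r scale0r.
    by rewrite /tang !scale0r addr0 scaler0.
  split; [exact: (dot_chart_tang)|exact: v0|].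
  (* the k for which II = k I when M v = (mu / metric) v *)
  exists (1 - exp_rho x y ^+ 2 * metric x y / mu) => w tw.
  rewrite [w](tangE tw) sf ff ME2 dotZl.
  by field; rewrite mu0 e0 g0.
Qed.

(** Where the Schwarzian vanishes the shape operator is a multiple of the
    identity. *)
Lemma S_neq0_of_nonumbilic x y : O x y -> immersed_at rho (chart A x y) ->
  ~ umbilic rho N (chart A x y) -> 0 < schw_re x y ^+ 2 + schw_im x y ^+ 2.
Proof.
move=> Oxy im num.
have e0 : exp_rho x y != 0 by rewrite gt_eqF // exp_rho_gt0.
have g0 : metric x y != 0 by rewrite gt_eqF // metric_gt0.
rewrite lt0r addr_ge0 ?sqr_ge0 // andbT paddr_eq0 ?sqr_ge0 // !sqrf_eq0.
apply/negP => /andP [/eqP S0 /eqP S1]; apply: num.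
have ME p q : shape_chart x y p q = (scaled_mean x y / metric x y) *: tang x y p q.
  rewrite /shape_chart /tang -/(scaled_mean x y) S0 S1 !scalerDr !scalerA.
  by congr (_ *: _ + _ *: _); field.
have k0 : scaled_mean x y != 0.
  apply/eqP => k0.
  have [|/eqP] := immersed_shape_inj (al := 1) (be := 0) Oxy im.
    by rewrite ME k0 mul0r scale0r.
  by rewrite oner_eq0.
exists (1 - exp_rho x y ^+ 2 * metric x y / scaled_mean x y) => v w tv tw.
rewrite [v](tangE tv) [w](tangE tw).
rewrite (first_form_tang Oxy).
rewrite (second_form_tang _ _ _ _ Oxy im) !ME !dotZl !dotZr.
by field; rewrite k0 e0 g0.
Qed.

End Normal.

End ConformalChart.

(** * Curves *)

Section Assembly.
Context {R : realType}.
Local Notation E := 'rV[R]_3.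
Local Notation C := (R[i])^o.
Local Notation Re := (@complex.Re R).
Local Notation Im := (@complex.Im R).

(** The half turn about the first axis exchanges the two poles. *)
Lemma exists_chart (th : E) : dot th th = 1 ->
  exists A x y, rotation A /\ chart A x y = th.
Proof.
move=> th1.
have key A : rotation A -> 1 - dot th (frame A 0 0 1) != 0 ->
    exists A x y, rotation A /\ chart A x y = th.
  by move=> rA nA; exists A, (chart_re A th), (chart_im A th); split=> //; exact: chartK.
have r1 : rotation (1%:M : 'M[R]_3).
  by split; [rewrite trmx1 mulmx1|rewrite det1].
have [h|h] := eqVneq (1 - dot th (frame 1%:M 0 0 1)) 0; last exact: (key _ r1).
pose d : 'rV[R]_3 := vec3 1 (-1) (-1).
have r2 : rotation (diag_mx d).
  split.
    rewrite tr_diag_mx mulmx_diag -diag_const_mx; congr diag_mx.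
    by apply/rowP => i; rewrite !mxE; case: i => [[|[|[|]]]] //= _; ring.
  by rewrite det_diag !big_ord_recl big_ord0 !mxE /=; ring.
apply: (key _ r2).
have -> : frame (diag_mx d) 0 0 1 = - frame 1%:M 0 0 1.
  rewrite /frame mulmx1; apply/rowP => j; rewrite !mxE !big_ord_recl big_ord0 !mxE.
  by case: j => [[|[|[|]]]] //= ?; ring.
move/eqP: h; rewrite subr_eq0 dotNr => /eqP <-.
by rewrite opprK -[1 + 1]/(2%:R) pnatr_eq0.
Qed.

Lemma interval_constant_sign (J : set R) (phi : R -> R) : is_interval J ->
  (forall s, J s -> {for s, continuous phi}) -> (forall s, J s -> phi s != 0) ->
  (forall s, J s -> 0 < phi s) \/ (forall s, J s -> phi s < 0).
Proof.
move=> iJ cphi nphi.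
have key a b : J a -> J b -> a <= b -> (phi a < 0) = (phi b < 0).
  move=> Ja Jb ab.
  have sub : `[a, b]%classic `<=` J.
    by move=> x /=; rewrite in_itv /= => abx; exact: (iJ a b).
  have cab : {within `[a, b]%classic, continuous phi}.
    by apply: continuous_in_subspaceT => x /set_mem /sub /cphi.
  apply/idP/idP => H; rewrite ltNge; apply/negP => H'.
  - have [|x xab px] := @IVT _ phi a b 0 ab cab.
      by rewrite ge_min le_max (ltW H) H' ?orbT.
    by have := nphi x (sub x xab); rewrite px eqxx.
  - have [|x xab px] := @IVT _ phi a b 0 ab cab.
      by rewrite ge_min le_max (ltW H) H' ?orbT.
    by have := nphi x (sub x xab); rewrite px eqxx.
have key2 a b : J a -> J b -> (phi a < 0) = (phi b < 0).
  by move=> Ja Jb; case: (leP a b) => [|/ltW] ab; [|apply/esym]; exact: key.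
have [[s0 [J0 p0]]|H] := pselect (exists s, J s /\ phi s < 0).
  by right => s Js; rewrite (key2 s s0).
left => s Js; rewrite lt0r nphi //= leNgt; apply/negP => ps.
by apply: H; exists s.
Qed.

Lemma cvg_dot (F G : R -> E) s : {for s, continuous F} -> {for s, continuous G} ->
  {for s, continuous (fun u => dot (F u) (G u))}.
Proof.
move=> cF cG; rewrite /dot; apply: cvg_big; first exact: add_continuous.
move=> i _.
apply: (@cvgM R _ (nbhs s) _ (fun u => F u ord0 i) (fun u => G u ord0 i)).
  by apply: (cvg_comp F (fun M : E => M ord0 i) cF); exact: coord_continuous.
by apply: (cvg_comp G (fun M : E => M ord0 i) cG); exact: coord_continuous.
Qed.

Variables (Omega : set E) (f : E -> C) (rhoO : E -> R) (t : R).
Hypotheses (dom : sphere_domain Omega) (conf : conformal_bijection Omega f)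
  (hrho : is_rho_Omega Omega f rhoO).
Local Notation rho := (fun th => rhoO th + t).

Lemma Omega_sphere th : Omega th -> dot th th = 1.
Proof. by case: dom => _ [U _ ->] _ []. Qed.

Section Normal.
Variable N : E -> E.
Hypothesis outN : outer_unit_normal Omega rho N.

Lemma gauss_map_inverse th xi : Omega th -> immersed_at rho th ->
  gauss_map rho N th xi <-> xi = th.
Proof.
move=> Oth im; have [A [x [y [rA pE]]]] := exists_chart (Omega_sphere Oth).
rewrite -pE in Oth im *.
rewrite /gauss_map (normal_chart dom conf hrho rA outN Oth im).
rewrite (R_map_chart t dom conf hrho rA Oth) /horo_normal.
have th1 := chart_sphere rA x y; have Pth := dot_axis_chart f rhoO t rA x y.
have e0 := exp_rho_gt0 rhoO t A x y.
apply: ideal_endpoint_horosphere => //.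
- exact: envelope_ball Pth e0.
- exact: envelope_horosphere Pth e0.
Qed.

Section Direction.
Variables th v : E.
Hypotheses (Oth : Omega th) (im : immersed_at rho th)
  (tv : tangent th v) (v0 : v <> 0).

(** [q_positive] and [q_negative] quantify over all charts; [tracefree] gives
    them a common sign. *)
Lemma principal_q : ~ umbilic rho N th -> principal_direction rho N th v ->
  [/\ tracefree rhoO t th v != 0,
      0 < tracefree rhoO t th v -> q_positive f th v
    & tracefree rhoO t th v < 0 -> q_negative f th v].
Proof.
move=> num pr.
have key A x y al be : rotation A -> chart A x y = th -> tang A x y al be = v ->
    q_im f A x y al be = 0 /\ q_re f A x y al be = tracefree rhoO t th v.
  move=> rA pE vE; move: Oth im pr v0; rewrite -pE -vE => Op imp pr' vn.
  rewrite (tracefree_chart t dom conf hrho rA _ _ Op); split => //.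
  by apply/(principal_chart dom conf hrho rA outN Op imp vn).
split.
- have [A [x [y [rA pE]]]] := exists_chart (Omega_sphere Oth).
  have tv' : dot (chart A x y) v = 0 by rewrite pE.
  have vE := esym (tangE rA tv').
  have [I0 <-] := key _ _ _ _ _ rA pE vE.
  move: I0 vE; set al := dot _ _; set be := dot _ _ => I0 vE.
  have S0 : 0 < schw_re f A x y ^+ 2 + schw_im f A x y ^+ 2.
    move: Oth im num; rewrite -pE => Op imp nump.
    exact: (S_neq0_of_nonumbilic dom conf hrho rA outN Op imp nump).
  have n0 : 0 < al ^+ 2 + be ^+ 2.
    rewrite lt0r addr_ge0 ?sqr_ge0 // andbT paddr_eq0 ?sqr_ge0 // !sqrf_eq0.
    apply/negP => /andP [/eqP al0 /eqP be0]; apply: v0.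
    by rewrite -vE al0 be0 /tang !scale0r addr0 scaler0.
  apply/eqP => R0; have : q_re f A x y al be ^+ 2 + q_im f A x y al be ^+ 2 =
      (schw_re f A x y ^+ 2 + schw_im f A x y ^+ 2) * (al ^+ 2 + be ^+ 2) ^+ 2.
    by rewrite /q_re /q_im; ring.
  rewrite R0 I0 expr0n addr0 /= => /esym /eqP.
  by rewrite mulf_eq0 expf_eq0 /= !gt_eqF.
- move=> T0 A [x y] [al be] rA pE; rewrite stereo_diffE => vE.
  have [I0 RE] := key _ _ _ _ _ rA pE vE.
  by rewrite ltcE Im_q_Omega Re_q_Omega I0 RE T0 eqxx.
- move=> T0 A [x y] [al be] rA pE; rewrite stereo_diffE => vE.
  have [I0 RE] := key _ _ _ _ _ rA pE vE.
  by rewrite ltcE Im_q_Omega Re_q_Omega I0 RE T0 eqxx.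
Qed.

Lemma q_principal : q_positive f th v \/ q_negative f th v ->
  principal_direction rho N th v.
Proof.
move=> H; have [A [x [y [rA pE]]]] := exists_chart (Omega_sphere Oth).
have tv' : dot (chart A x y) v = 0 by rewrite pE.
have vE := tangE rA tv'.
set al := dot _ _ in vE; set be := dot _ _ in vE.
have I0 : q_im f A x y al be = 0.
  have sd : stereo_diff A (x +i* y)%C (al +i* be)%C = v by rewrite stereo_diffE [RHS]vE.
  case: H => /(_ _ _ _ rA pE sd); rewrite ltcE Im_q_Omega => /andP [/eqP /= I0 _] //.
move: Oth im v0; rewrite -pE vE => Op imp vn.
by apply/(principal_chart dom conf hrho rA outN Op imp vn).
Qed.

End Direction.
End Normal.

Section CurveOnSphere.
Variables (J : set R) (c : R -> E).
Hypotheses (oJ : open J) (cJ : regular_curve J c)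
  (cO : forall s, J s -> Omega (c s)).

Lemma near_J s : J s -> \forall u \near s, J u.
Proof. by move=> Js; apply: open_nbhs_nbhs. Qed.

Lemma curve_tangent s : J s -> dot (c s) (derive1 c s) = 0.
Proof.
move=> Js; have [/derP Hc _ _] := cJ Js.
have H1 := der_dot Hc Hc.
have H2 : has_der (fun u => dot (c u) (c u)) s 0.
  apply: der_near (derC 1 s); apply: filterS (near_J Js) => u Ju.
  by rewrite Omega_sphere //; exact: cO.
have := der_uniq H1 H2; rewrite (dotC (derive1 c s)) => H.
by apply: (mulfI (_ : 2 != 0 :> R)); rewrite ?pnatr_eq0 // mulr0 -[RHS]H; ring.
Qed.

(** The sign of the quadratic differential along a curve of principal directions
    can then only change on an interval through a zero. *)
Lemma tracefree_continuous s : J s ->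
  {for s, continuous (fun u => tracefree rhoO t (c u) (derive1 c u))}.
Proof.
move=> Js; have [A [x [y [rA pE]]]] := exists_chart (Omega_sphere (cO Js)).
have [/derP Hc cc _] := cJ Js.
have n0 : 1 - dot (c s) (frame A 0 0 1) != 0 by rewrite -pE chart_not_pole.
have [Ha Hb] := der_chart_coords rA Hc (Omega_sphere (cO Js)) n0 (curve_tangent Js).
have Oab : Omega (chart A (chart_re A (c s)) (chart_im A (c s))).
  by rewrite chartK //; [exact: cO|exact/Omega_sphere/cO].
have [[d1 D1] [d2 D2]] := der_schw_parts dom conf rA Ha Hb Oab.
pose al u := dot (grad_re A (chart_re A (c u)) (chart_im A (c u))) (derive1 c u).
pose be u := dot (grad_im A (chart_re A (c u)) (chart_im A (c u))) (derive1 c u).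
have cal : {for s, continuous al}.
  exact: (cvg_dot (der_cont (der_grad_re A Ha Hb)) cc).
have cbe : {for s, continuous be}.
  exact: (cvg_dot (der_cont (der_grad_im A Ha Hb)) cc).
have [d3 D3] : exists d, has_der (fun u => 1 - dot (c u) (frame A 0 0 1)) s d.
  by eexists; repeat der_step.
have E1 : \forall u \near s, q_re f A (chart_re A (c u)) (chart_im A (c u)) (al u) (be u) =
    tracefree rhoO t (c u) (derive1 c u).
  apply: filterS2 (near_J Js) (der_near_neq0 D3 n0) => u Ju nu.
  have pu := chartK rA (Omega_sphere (cO Ju)) nu.
  have Ou : Omega (chart A (chart_re A (c u)) (chart_im A (c u))) by rewrite pu; exact: cO.
  rewrite -(tracefree_chart t dom conf hrho rA _ _ Ou) /al /be.
  by rewrite -tangE ?pu //; exact: curve_tangent.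
have C1 : {for s, continuous (fun u =>
    q_re f A (chart_re A (c u)) (chart_im A (c u)) (al u) (be u))}.
  have c1 := der_cont D1; have c2 := der_cont D2.
  have M (p q : R -> R) : {for s, continuous p} -> {for s, continuous q} ->
    {for s, continuous (fun u => p u * q u)} by move=> ? ?; exact: cvgM.
  have B (p q : R -> R) : {for s, continuous p} -> {for s, continuous q} ->
    {for s, continuous (fun u => p u - q u)} by move=> ? ?; exact: cvgB.
  have K : {for s, continuous (fun _ : R => 2 : R)} by exact: cvg_cst.
  exact: (B _ _ (M _ _ c1 (B _ _ (M _ _ cal cal) (M _ _ cbe cbe)))
                (M _ _ c2 (M _ _ (M _ _ K cal) cbe))).
have E0 : q_re f A (chart_re A (c s)) (chart_im A (c s)) (al s) (be s) =
  tracefree rhoO t (c s) (derive1 c s) := nbhs_singleton E1.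
have C2 : (fun u => q_re f A (chart_re A (c u)) (chart_im A (c u)) (al u) (be u)) @ s -->
    tracefree rhoO t (c s) (derive1 c s) by rewrite -E0; exact: C1.
apply: cvg_trans C2; apply: near_eq_cvg.
exact: E1.
Qed.

End CurveOnSphere.

End Assembly.

Lemma regular_curve_eq (R : realType) (J : set R) (c g : R -> 'rV[R]_3) :
  open J -> (forall s, J s -> c s = g s) -> regular_curve J c ->
  regular_curve J g /\ forall s, J s -> derive1 g s = derive1 c s.
Proof.
move=> oJ cg cJ.
have nJ s : J s -> \forall u \near s, J u by move=> Js; apply: open_nbhs_nbhs.
have dg s : J s -> has_der g s (derive1 c s).
  move=> Js; have [/derP Hc _ _] := cJ s Js.
  by apply: der_near Hc; apply: filterS (nJ s Js) => u /cg.
have E s : J s -> derive1 g s = derive1 c s by move/dg/der_val.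
split=> // s Js; have [_ cc c0] := cJ s Js; split.
- by case: (dg s Js).
- have C2 : derive1 c @ s --> derive1 g s by rewrite E //; exact: cc.
  apply: cvg_trans C2; apply: near_eq_cvg.
  have : \forall u \near s, derive1 c u = derive1 g u.
    by apply: filterS (nJ s Js) => u /E ->.
  exact.
- by rewrite E.
Qed.

Theorem theorem7p8 (R : realType) (Omega : set 'rV[R]_3)
    (f : 'rV[R]_3 -> (R[i])^o) (rhoO : 'rV[R]_3 -> R) (alpha : R)
    (N : 'rV[R]_3 -> 'rV[R]_3) :
  sphere_domain Omega ->
  simply_connected Omega ->
  more_than_two_points (sphere_boundary Omega) ->
  conformal_bijection Omega f ->
  is_rho_Omega Omega f rhoO ->
  alpha < 0 ->
  let t := - (2^-1 * ln (- alpha)) in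
  let rho := fun theta => rhoO theta + t in
  outer_unit_normal Omega rho N ->
  forall (J : set R) (g : R -> 'rV[R]_3), open_interval J ->
    (exists c : R -> 'rV[R]_3,
       line_of_curvature Omega rho N J c /\
       (forall s, J s -> gauss_map rho N (c s) (g s)))
    <->
    ((forall s, J s -> smooth_nonumbilic Omega rho N (g s)) /\
     (positive_trajectory Omega f J g \/ negative_trajectory Omega f J g)).
Proof.
move=> dom _ _ conf hrho _ t rho outN J g [_ oJ iJ].
split=> [[c [[cJ cL] cg]]|[gS gT]].
- have gc s : J s -> c s = g s.
    move=> Js; have [[Os im _] _] := cL s Js.
    by apply/esym; apply/(gauss_map_inverse dom conf hrho outN _ Os im); exact: cg.
  have [gJ dE] := regular_curve_eq oJ gc cJ.
  have gL s : J s -> smooth_nonumbilic Omega rho N (g s) /\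
      principal_direction rho N (g s) (derive1 g s).
    by move=> Js; rewrite dE // -gc //; exact: cL.
  have gO s : J s -> Omega (g s) by case/gL => [[]].
  split; first by move=> s /gL [].
  have pt s (Js : J s) : [/\ tracefree rhoO t (g s) (derive1 g s) != 0,
      0 < tracefree rhoO t (g s) (derive1 g s) -> q_positive f (g s) (derive1 g s)
    & tracefree rhoO t (g s) (derive1 g s) < 0 -> q_negative f (g s) (derive1 g s)].
    have [[Os im num] pr] := gL s Js; have [_ _ g0] := gJ s Js.
    have [tv _ _] := pr.
    exact: (principal_q dom conf hrho outN Os im tv g0 num pr).
  have cont s (Js : J s) := tracefree_continuous (t := t) dom conf hrho oJ gJ gO Js.
  have n0 s : J s -> tracefree rhoO t (g s) (derive1 g s) != 0 by case/pt.
  have [H|H] := interval_constant_sign iJ cont n0; [left|right]; split=> // s Js.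
    by split; [exact: gO|have [_ P _] := pt s Js; apply: P; exact: H].
  by split; [exact: gO|have [_ _ P] := pt s Js; apply: P; exact: H].
- have gJ : regular_curve J g by case: gT => -[].
  have gO s : J s -> Omega (g s) by case/gS.
  have gq s : J s -> q_positive f (g s) (derive1 g s) \/ q_negative f (g s) (derive1 g s).
    by move=> Js; case: gT => -[_ /(_ s Js) [_ ?]]; [left|right].
  exists g; split; last first.
    by move=> s Js; have [Os im _] := gS s Js; apply/(gauss_map_inverse dom conf hrho outN _ Os im).
  split=> // s Js; split; first exact: gS.
  have [Os im _] := gS s Js; have [_ _ g0] := gJ s Js.
  have tv := curve_tangent dom oJ gJ gO Js.
  exact: (q_principal dom conf hrho outN Os im tv g0 (gq s Js)).
Qed.
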